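(* Let $H\in(0,1)$, $x_0\in\mathbb R$, and for $\theta\in\mathbb R$ let $X=\{X_t,t\ge0\}$ be the fractional Ornstein--Uhlenbeck process with drift parameter $\theta$, initial value $x_0$ and Hurst parameter $H$. For $t>1$ let $Z(t)=\frac{\log^+\log|X_t|}{\log t}$. Then for $t>1$ the probability $g(\theta,x_0,t,c)=\mathbf P(Z(t)\le c)$ is given by $$g(\theta,x_0,t,c)=\Phi\left(\frac{e^{t^c}-x_0e^{\theta t}}{\sqrt{v(\theta,t)}}\right)+\Phi\left(\frac{e^{t^c}+x_0e^{\theta t}}{\sqrt{v(\theta,t)}}\right)-1,$$ and $g$ is a decreasing function of $\theta\in\mathbb R$.
   Context: Let $B^H=\{B^H_t,t\in\mathbb R\}$ be a fractional Brownian motion with Hurst parameter $H\in(0,1)$ on a probability space $(\Omega,\mathcal F,\mathbf P)$, i.e. a centered Gaussian process with $\mathbf E B^H_tB^H_s=\frac12(|t|^{2H}+|s|^{2H}-|t-s|^{2H})$, taken in its continuous modification. The fractional Ornstein--Uhlenbeck process $X$ is the unique solution of $X_t=x_0+\theta\int_0^tX_s\,ds+B^H_t$, $t\ge0$; equivalently $X_t=x_0e^{\theta t}+\theta e^{\theta t}\int_0^te^{-\theta s}B^H_s\,ds+B^H_t$. Here $\log^+y=\log y$ if $y>1$ and $\log^+y=0$ otherwise (including $y\le0$ and $y=\log0=-\infty$). The real number $c$ is the argument of the cumulative distribution function of $Z(t)$. $\Phi$ is the cumulative distribution function of the standard normal law, and $$v(\theta,t)=H\int_0^ts^{2H-1}\left(e^{\theta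 s}+e^{\theta(2t-s)}\right)ds$$ is the variance of $X_t$.
   Formalization: The formula and strict decrease in θ are claimed only for c ≥ 0 (for c < 0, P(Z(t) ≤ c) = 0 since Z(t) ≥ 0, while the displayed expression is positive, so the formula fails there); for c < 0 only weak monotonicity is claimed. *)

(* Defs.v *)
From HB Require Import structures.
From mathcomp Require Import all_boot all_order all_algebra.
From mathcomp Require Import all_classical all_reals all_analysis.

Set Implicit Arguments.
Unset Strict Implicit.
Unset Printing Implicit Defensive.

Import Order.TTheory GRing.Theory Num.Theory.
Import numFieldNormedType.Exports.

Local Open Scope classical_set_scope.
Local Open Scope ring_scope.

(* [normal_prob m 0] is a uniform law in the library, hence the case split:
   the Gaussian law with zero standard deviation is the Dirac mass at [m]. *)
Definition gaussian_law (R : realType) (m s : R) (A : set R) : \bar R :=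
  if s == 0 then \d_m A else normal_prob m s A.

Definition is_gaussian d (T : measurableType d) (R : realType)
    (P : probability T R) (Y : T -> R) : Prop :=
  exists m s : R, forall A : set R, measurable A ->
    P (Y @^-1` A) = gaussian_law m s A.

Definition is_gaussian_process d (T : measurableType d) (R : realType)
    (P : probability T R) (B : R -> {RV P >-> R}) : Prop :=
  forall (n : nat) (a u : 'I_n -> R),
    is_gaussian P (fun w => \sum_(i < n) a i * B (u i) w).

Definition is_fBm d (T : measurableType d) (R : realType)
    (P : probability T R) (H : R) (B : R -> {RV P >-> R}) : Prop :=
  [/\ is_gaussian_process B,
      forall t : R, ('E_P[B t] = 0)%E,
      forall t s : R, 'E_P[fun w => (B t w * B s w)%R]%E =
        (2^-1 * (`|t| `^ (2 * H) + `|s| `^ (2 * H)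
                 - `|t - s| `^ (2 * H)))%:E
    & {ae P, forall w, continuous (fun t : R => B t w)}].

(* Only the values at times t >= 0 are constrained. *)
Definition is_fOU d (T : measurableType d) (R : realType)
    (P : probability T R) (B : R -> {RV P >-> R}) (theta x0 : R)
    (X : R -> {RV P >-> R}) : Prop :=
  {ae P, forall w, forall t : R, 0 <= t ->
    lebesgue_measure.-integrable `[0, t] (fun s => (X s w)%:E) /\
    X t w = x0 + theta * (\int[lebesgue_measure]_(s in `[0, t]) X s w)
            + B t w}.

Definition logplus (R : realType) (y : \bar R) : \bar R :=
  if (1 < y)%E then lne y else 0%E.

(* The value of Z(t) when X_t = x; [lne 0 = -oo], so Z(t) = 0 at x = 0. *)
Definition Zstat (R : realType) (t x : R) : R :=
  fine (logplus (lne (`|x|%:E))) / ln t.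

Definition gprob d (T : measurableType d) (R : realType)
    (P : probability T R) (X : R -> {RV P >-> R}) (t c : R) : \bar R :=
  P [set w | Zstat t (X t w) <= c].

Definition Phi (R : realType) (x : R) : R :=
  fine (normal_prob 0 1 `]-oo, x]).

Definition vOU (R : realType) (H theta t : R) : R :=
  H * \int[lebesgue_measure]_(s in `[0, t])
        (s `^ (2 * H - 1) * (expR (theta * s) + expR (theta * (2 * t - s)))).

(* Main.v *)
(* Put [p = 2H].  Solving the linear equation along a continuous path gives
   [X_t - x0 e^{theta t} = B_t + int_0^t theta e^{theta (t - s)} B_s ds],
   which is an almost sure limit of centred Gaussian Riemann sums; their laws
   are determined by their variances, which converge to
     [e^{theta t} t^p + theta / 2 (e^{2 theta t} E(t) + E(-t))],
   where [E' x = e^{-theta x} |x|^p] and [E 0 = 0].  The same expression is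
   obtained by integrating [vOU] by parts, so [X_t] has law
   [N(x0 e^{theta t}, vOU)], whence the formula.

   For the monotonicity write [m = x0 e^{theta t}], [s = sqrt vOU] and
   [K = e^{t^c}].  When theta increases to theta', [|m|] is multiplied by
   [r = e^{(theta' - theta) t}] and [s] by a factor in [(1, r]].  Hence [K / s]
   decreases and [|m| / s] does not, and both changes lower the probability
   that a normal variable of mean [m / s] and variance 1 lies in
   [[-K / s, K / s]]. *)
Require Import Defs.
From HB Require Import structures.
From mathcomp Require Import all_boot all_order all_algebra.
From mathcomp Require Import ring lra.
From mathcomp Require Import all_classical all_reals all_analysis.
From mathcomp Require Import measurable_realfun.

Set Implicit Arguments.
Unset Strict Implicit.
Unset Printing Implicit Defensive.

Import Order.TTheory GRing.Theory Num.Theory.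
Import numFieldNormedType.Exports.

Local Open Scope classical_set_scope.
Local Open Scope ring_scope.

(** * Calculus: derivative rules, primitives, uniform continuity on a square *)

Section derivatives.
Context {R : realType}.
Implicit Types (f g F : R -> R) (x : R).

Lemma is_derive_addf f g x (a b : R) : is_derive x 1 f a ->
  is_derive x 1 g b -> is_derive x 1 (fun y => f y + g y) (a + b).
Proof. by move=> df dg; exact: is_deriveD. Qed.

Lemma is_derive_subf f g x (a b : R) : is_derive x 1 f a ->
  is_derive x 1 g b -> is_derive x 1 (fun y => f y - g y) (a - b).
Proof. by move=> df dg; exact: is_deriveB. Qed.

Lemma is_derive_mulcf (c : R) f x (a : R) : is_derive x 1 f a ->
  is_derive x 1 (fun y => c * f y) (c * a).
Proof. by move=> df; exact: is_deriveZ. Qed.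

Lemma is_derive_compf f g x (a b : R) : is_derive (g x) 1 f a ->
  is_derive x 1 g b -> is_derive x 1 (fun y => f (g y)) (a * b).
Proof. by move=> df dg; exact: is_derive1_comp. Qed.

Lemma is_derive_affine (c d x : R) : is_derive x 1 (fun y : R => c + d * y) d.
Proof.
rewrite -[X in is_derive _ _ _ X]add0r -[X in _ + X]mulr1.
by apply: is_derive_addf; apply: is_derive_mulcf.
Qed.

Lemma is_derive_expR_affine (c d x : R) :
  is_derive x 1 (fun y : R => expR (c + d * y)) (d * expR (c + d * x)).
Proof.
by rewrite mulrC; apply: is_derive_compf (is_derive_affine c d x).
Qed.

Lemma is_derive_continuous f x (a : R) : is_derive x 1 f a ->
  {for x, continuous f}.
Proof. by move=> df; exact/differentiable_continuous/derivable1_diffP. Qed.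

Lemma eq_of_is_derive_eq F f g : (forall x, is_derive x 1 f (F x)) ->
  (forall x, is_derive x 1 g (F x)) ->
  forall x y, f x - f y = g x - g y.
Proof.
move=> df dg x y; apply/eqP; rewrite -subr_eq0; apply/eqP.
have : (fun u : R => f u - g u) x = (fun u => f u - g u) y.
  apply: (@is_derive_0_is_cst _ (fun u : R => f u - g u)) => z.
  by rewrite -(subrr (F z)); exact: is_derive_subf.
by move=> /=; lra.
Qed.

Lemma MVT_within f F (a b : R) : a <= b ->
  (forall x, a < x -> x < b -> is_derive x 1 f (F x)) ->
  {within `[a, b], continuous f} ->
  exists2 c, a <= c <= b & f b - f a = F c * (b - a).
Proof.
move=> ab df cf; have [|c] := @MVT_segment _ f F a b ab _ cf.
  by move=> x; rewrite in_itv/= => /andP[? ?]; exact: df.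
by rewrite in_itv/= => c_ab fE; exists c.
Qed.

(** Near [x] the candidate [F] differs by a constant from the integral over [[a, y]], where [a] lies
    to the left of both [x] and [0]; the fundamental theorem with fixed base point [a] then
    applies. *)
Lemma continuous_antiderivative f : continuous f ->
  exists F, forall x, is_derive x 1 F (f x).
Proof.
move=> cf.
pose mu := @lebesgue_measure R.
have fint (a b : R) : mu.-integrable `[a, b] (EFin \o f).
  apply: continuous_compact_integrable; first exact: segment_compact.
  exact: continuous_subspaceT.
(* At least one of the two sets is empty or a point, so [F] is the oriented integral from [0] to
   [x]. *)
pose F (x : R) : R := \int[mu]_(s in `[0, x]) f s - \int[mu]_(s in `[x, 0]) f s.
exists F => x.
pose a := - (`|x| + 1); pose u := `|x| + 1.
have ax : a < x by rewrite /a; have := ler_norm (- x); rewrite normrN; lra.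
have xu : x < u by rewrite /u; have := ler_norm x; lra.
have a0 : a <= 0 by rewrite /a; have := normr_ge0 x; lra.
pose G (y : R) : R := \int[mu]_(s in `[a, y]) f s.
have [dG GE] := continuous_FTC1_closed xu (fint a u) ax (cf x).
have GB (y z : R) : a <= y -> y <= z ->
    G z - G y = \int[mu]_(s in `[y, z]) f s.
  move=> ay yz; rewrite /G Rintegral_itvB ?bnd_simp//.
  rewrite Rintegral_itv_obnd_cbnd//.
  apply: (integrableS _ _ _ (fint y z)) => //.
  exact: subset_itv_oc_cc.
have FG (y : R) : a < y -> F y = G y - G 0.
  move=> ay; rewrite /F; have [y0|y0] := leP 0 y.
    rewrite GB//; have [->|yn0] := eqVneq y 0.
      by rewrite set_itv1 Rintegral_set1 subrr.
    rewrite [in X in _ - X]set_itv_ge ?Rintegral_set0 ?subr0//.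
    by rewrite bnd_simp -ltNge lt_neqAle eq_sym yn0.
  rewrite -(GB y 0) ?(ltW ay) ?(ltW y0)//.
  rewrite set_itv_ge ?Rintegral_set0 ?bnd_simp -?ltNge//; lra.
apply: (@near_eq_is_derive _ _ _ (fun y : R => G y - G 0)).
  near=> y; rewrite FG//; near: y; exact: lt_nbhsr.
rewrite -[f x]subr0; apply: is_derive_subf.
by apply: DeriveDef; [exact: dG|rewrite -derive1E].
Unshelve. all: end_near. Qed.

(** Heine's theorem on the compact square, with one modulus serving every first coordinate. *)
Lemma continuous_square_unif (f : R * R -> R) (a b e : R) :
  continuous f -> 0 < e ->
  \forall d \near (0:R)^'+, forall s x y, a <= s <= b -> a <= x <= b ->
    `|x - y| < d -> `|f (s, x) - f (s, y)| < e.
Proof.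
move=> cf e0.
have /compact_near_coveringP K := compact_setX (@segment_compact R a b)
  (@segment_compact R a b).
have : \forall d \near (0:R)^'+, forall z, (`[a, b] `*` `[a, b])%classic z ->
    forall y, `|z.2 - y| < d -> `|f z - f (z.1, y)| < e.
  apply: (K _ _
    (fun d z => forall y, `|z.2 - y| < d -> `|f z - f (z.1, y)| < e)) => z _.
  have e20 : 0 < e / 2 by rewrite divr_gt0.
  have := cf z; move/cvgrPdist_lt/(_ _ e20) => /=.
  move=> /nbhs_ballP[r /= r0 rz].
  (* Halving [r] keeps both [z'] and [(z'.1, y)] in the ball of radius [r] about [z]. *)
  exists (ball z (r / 2), [set d | d < r / 2]); first split => /=.
  - by apply: nbhsx_ballx; rewrite divr_gt0.
  - by apply: nbhs_right_lt; rewrite divr_gt0.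
  move=> [z' d] /= [[zz'1 zz'2] dr] y xy.
  rewrite /ball/= in zz'1 zz'2.
  have fz' : `|f z - f z'| < e / 2 by apply: rz; split; rewrite /ball/=; lra.
  have fy : `|f z - f (z'.1, y)| < e / 2.
    apply: rz; split; rewrite /ball/=; first lra.
    rewrite (_ : z.2 - y = (z.2 - z'.2) + (z'.2 - y)); last lra.
    by rewrite (le_lt_trans (ler_normD _ _))//; lra.
  rewrite (_ : f z' - _ = - (f z - f z') + (f z - f (z'.1, y))); last lra.
  by rewrite (le_lt_trans (ler_normD _ _))// normrN; lra.
apply: filterS => d H s x y sab xab xy; exact: (H (s, x)).
Qed.

End derivatives.

(** * Riemann sums at left nodes and their convergence *)

Section riemann_sums.
Context {R : realType}.
Implicit Types (f g F : R -> R) (t : R).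

Definition riemann_sum t (n : nat) f : R :=
  \sum_(i < n) t / n%:R * f (i%:R * (t / n%:R)).

Lemma riemann_sum_node t (n : nat) (i : 'I_n.+1) : 0 <= t ->
  0 <= i%:R * (t / n.+1%:R) <= t.
Proof.
move=> t0; rewrite mulr_ge0 ?divr_ge0//=.
by rewrite mulrCA ler_piMr// ler_pdivrMr// mul1r ler_nat ltnW.
Qed.

Lemma sumr_mesh t (e : R) n : \sum_(i < n.+1) t / n.+1%:R * e = e * t.
Proof. by rewrite sumr_const card_ord -[LHS]mulr_natr mulrAC divfK// mulrC. Qed.

Lemma le_riemann_sum_dist t n f g (e : R) : 0 <= t ->
  (forall x : R, 0 <= x <= t -> `|f x - g x| <= e) ->
  `|riemann_sum t n.+1 f - riemann_sum t n.+1 g| <= e * t.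
Proof.
move=> t0 fg; rewrite /riemann_sum -sumrB.
rewrite (le_trans (ler_norm_sum _ _ _))//.
apply: (@le_trans _ _ (\sum_(i < n.+1) t / n.+1%:R * e)).
  apply: ler_sum => i _; rewrite -mulrBr normrM ger0_norm ?divr_ge0//.
  by rewrite ler_wpM2l ?divr_ge0// fg// riemann_sum_node.
by rewrite sumr_mesh.
Qed.

(** Telescope [F t - F 0] over the mesh; on each cell the mean value theorem turns the increment
    into the mesh size times a value of [f], which is within [e] of its value at the left node. *)
Lemma riemann_sum_error F f t n (e : R) : 0 <= t ->
  (forall x : R, is_derive x 1 F (f x)) ->
  (forall x y : R, 0 <= x <= t -> 0 <= y <= t -> `|x - y| <= t / n.+1%:R ->
    `|f x - f y| <= e) ->
  `|riemann_sum t n.+1 f - (F t - F 0)| <= e * t.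
Proof.
move=> t0 dF fe; set h := t / n.+1%:R.
have h0 : 0 <= h by rewrite divr_ge0.
have -> : F t - F 0 = \sum_(i < n.+1) (F (i.+1%:R * h) - F (i%:R * h)).
  rewrite -(big_mkord xpredT (fun i => F (i.+1%:R * h) - F (i%:R * h))).
  rewrite (telescope_sumr (fun i => F (i%:R * h)))// mul0r.
  by rewrite /h mulrCA mulfV// mulr1.
rewrite /riemann_sum -sumrB (le_trans (ler_norm_sum _ _ _))//.
apply: (@le_trans _ _ (\sum_(i < n.+1) h * e)); last first.
  by rewrite sumr_mesh.
apply: ler_sum => i _; rewrite -/h.
have ih : i%:R * h <= i.+1%:R * h by rewrite ler_wpM2r// ler_nat.
have [|c /andP[ic ci] ->] := @MVT_within _ F f _ _ ih.
  by apply: continuous_subspaceT => x; exact: is_derive_continuous (dF x).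
have -> : i.+1%:R * h - i%:R * h = h by rewrite -mulrBl -natrB// subSnn mul1r.
rewrite [f c * h]mulrC -mulrBr normrM (ger0_norm h0) ler_wpM2l//.
have /andP[i0 it] := riemann_sum_node i t0.
have iSt : i.+1%:R * h <= t.
  by rewrite /h mulrCA ler_piMr// ler_pdivrMr// mul1r ler_nat.
rewrite -/h in it i0.
apply: fe.
- by rewrite i0.
- by rewrite (le_trans i0 ic) (le_trans ci iSt).
- rewrite ler_norml; move: ci; rewrite -natr1 mulrDl mul1r => ci.
  by apply/andP; split; rewrite -/h; lra.
Qed.

Lemma near_mesh t (d : R) : 0 < d -> \forall n \near \oo, t / n.+1%:R < d.
Proof.
move=> d0.
have : t * n.+1%:R^-1 @[n --> \oo] --> t * (0 : R).
  by apply: cvgM; [exact: cvg_cst|exact: cvg_harmonic].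
by rewrite mulr0 => /cvgr_lt; exact.
Qed.

(** Uniformity in [s] is what a double Riemann sum requires: the inner sum is replaced by its limit
    at all outer nodes at once. *)
Lemma riemann_sum_unif (K : R * R -> R) (A : R -> R -> R) t : 0 <= t ->
  continuous K -> (forall s x : R, is_derive x 1 (A s) (K (s, x))) ->
  forall e : R, 0 < e -> \forall n \near \oo, forall s : R, 0 <= s <= t ->
    `|riemann_sum t n.+1 (fun x => K (s, x)) - (A s t - A s 0)| <= e.
Proof.
move=> t0 cK dA e e0.
(* Dividing by [t + 1] instead of [t] covers [t = 0]. *)
have e'0 : 0 < e / (t + 1) by rewrite divr_gt0// ltr_wpDl.
have [d /= [d0 Kd]] : exists d, 0 < d /\ forall s x y : R, 0 <= s <= t ->
    0 <= x <= t -> `|x - y| < d -> `|K (s, x) - K (s, y)| < e / (t + 1).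
  have := @continuous_square_unif R K 0 t _ cK e'0 => H.
  near ((0:R)^'+) => d; exists d; split; first by near: d; exact: nbhs_right_gt.
  by near: d.
near=> n => s st.
apply: (@le_trans _ _ (e / (t + 1) * t)).
  apply: riemann_sum_error => // x y xt yt xy.
  apply/ltW/Kd => //; rewrite (le_lt_trans xy)//; near: n; exact: near_mesh.
by rewrite mulrAC ler_pdivrMr ?ltr_wpDl// ler_wpM2l ?(ltW e0)// lerDl.
Unshelve. all: end_near. Qed.

Lemma cvg_riemann_sum F f t : 0 <= t -> continuous f ->
  (forall x : R, is_derive x 1 F (f x)) ->
  riemann_sum t n.+1 f @[n --> \oo] --> F t - F 0.
Proof.
move=> t0 cf dF; apply/cvgrPdist_le => e e0.
have cK : continuous (fun z : R * R => f z.2).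
  by move=> z; apply: continuous_comp; [exact: cvg_snd|exact: cf].
have := riemann_sum_unif (A := fun=> F) t0 cK (fun _ => dF) e0.
apply: filterS => n /(_ 0); rewrite lexx t0 distrC; exact.
Qed.

Lemma cvg_riemann_sum_unif (g_ : nat -> R -> R) g t (l : R) : 0 <= t ->
  (forall e : R, 0 < e -> \forall n \near \oo, forall s : R, 0 <= s <= t ->
    `|g_ n s - g s| <= e) ->
  riemann_sum t n.+1 g @[n --> \oo] --> l ->
  riemann_sum t n.+1 (g_ n) @[n --> \oo] --> l.
Proof.
move=> t0 gg cg; apply/cvgrPdist_le => e e0.
have e20 : 0 < e / 2 by rewrite divr_gt0.
have e'0 : 0 < e / 2 / (t + 1) by rewrite divr_gt0// ltr_wpDl.
near=> n.
have H1 : `|l - riemann_sum t n.+1 g| <= e / 2.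
  by near: n; move/cvgrPdist_le : cg; exact.
have H2 : `|riemann_sum t n.+1 g - riemann_sum t n.+1 (g_ n)| <= e / 2.
  rewrite distrC; apply: (@le_trans _ _ (e / 2 / (t + 1) * t)).
    by apply: le_riemann_sum_dist => //; near: n; exact: gg.
  by rewrite mulrAC ler_pdivrMr ?ltr_wpDl// ler_wpM2l ?(ltW e20)// lerDl.
rewrite -(subrKA (riemann_sum t n.+1 g)) (le_trans (ler_normD _ _))//.
by rewrite (splitr e) lerD.
Unshelve. all: end_near. Qed.

End riemann_sums.

(** * The covariance function of fractional Brownian motion *)

Section covariance.
Context {R : realType}.
Implicit Types (p s t u x theta : R).

(** Away from [0] the power is differentiable; at [0], [|y|^p < e] as soon as [|y| < e^{1/p}]. *)
Lemma continuous_normr_powR p : 0 < p -> continuous (fun x : R => `|x| `^ p).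
Proof.
move=> p0 x; have [->|x0] := eqVneq x 0; last first.
  apply: (@continuous_comp _ _ _ (fun y : R => `|y|) (fun y => y `^ p)).
    exact: norm_continuous.
  apply: is_derive_continuous (is_derive1_powR p _).
  by rewrite normr_gt0.
apply/cvgrPdist_lt => e e0; rewrite normr0 powR0 ?gt_eqF//.
near=> y; rewrite sub0r normrN (ger0_norm (powR_ge0 _ _)).
have [->|y0] := eqVneq y 0; first by rewrite normr0 powR0 ?gt_eqF.
rewrite -[e](powRr1 (ltW e0)) -(mulVf (lt0r_neq0 p0)) powRrM.
apply: gt0_ltr_powR => //; rewrite ?nnegrE ?powR_ge0//.
near: y.
have : `|y| @[y --> (0:R)] --> `|0:R| by exact: norm_continuous.
by rewrite normr0 => /cvgr_lt; apply; rewrite powR_gt0.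
Unshelve. all: end_near. Qed.

Lemma is_derive_normr_powR p x : 0 < x ->
  is_derive x 1 (fun y : R => `|y| `^ p) (p * x `^ (p - 1)).
Proof.
move=> x0; apply: (@near_eq_is_derive _ _ _ (fun y : R => y `^ p)).
  by near=> y; rewrite ger0_norm// ltW//; near: y; exact: lt_nbhsr.
exact: is_derive1_powR.
Unshelve. all: end_near. Qed.

Definition fBm_cov p s t : R := 2^-1 * (`|s| `^ p + `|t| `^ p - `|s - t| `^ p).

Lemma fBm_covC p s t : fBm_cov p s t = fBm_cov p t s.
Proof. by rewrite /fBm_cov distrC [X in X - _]addrC. Qed.

Lemma fBm_cov_diag p t : 0 < p -> fBm_cov p t t = `|t| `^ p.
Proof.
by move=> p0; rewrite /fBm_cov subrr normr0 powR0 ?gt_eqF// subr0; lra.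
Qed.

Lemma continuous_fBm_cov p : 0 < p ->
  continuous (fun z : R * R => fBm_cov p z.1 z.2).
Proof.
move=> p0 z; apply: cvgM; first exact: cvg_cst.
apply: cvgB; first apply: cvgD.
- by apply: (cvg_comp _ (fun x : R => `|x| `^ p)); [exact: cvg_fst|
    exact: continuous_normr_powR].
- by apply: (cvg_comp _ (fun x : R => `|x| `^ p)); [exact: cvg_snd|
    exact: continuous_normr_powR].
- apply: (cvg_comp (fun x : R * R => x.1 - x.2) (fun x : R => `|x| `^ p)).
    by apply: cvgB; [exact: cvg_fst|exact: cvg_snd].
  exact: continuous_normr_powR.
Qed.

End covariance.

(** * Closed form of the limit variance *)

Section variance.
Context {R : realType}.
Variables (p theta : R) (E : R -> R).
Hypothesis p0 : 0 < p.
Hypothesis dE : forall x : R, is_derive x 1 E (expR (- theta * x) * `|x| `^ p).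
Hypothesis E0 : E 0 = 0.
Implicit Types (s t u x : R).

(** The kernel [theta e^{theta (t - s)}] of the variation of constants formula; the affine exponent
    is the form expected by [is_derive_expR_affine]. *)
Definition OU_kernel t s : R := theta * expR (theta * t + - theta * s).

Definition OU_variance t : R := expR (theta * t) * t `^ p +
  2^-1 * theta * (expR (theta * t) ^+ 2 * E t + E (- t)).

Let continuous_E : continuous E.
Proof. by move=> x; exact: is_derive_continuous (dE x). Qed.

Lemma continuous_OU_kernel t : continuous (OU_kernel t).
Proof.
move=> x; have dexp := is_derive_expR_affine (theta * t) (- theta) x.
exact: is_derive_continuous (is_derive_mulcf theta dexp).
Qed.

(** Termwise primitive in [u] of the kernel times the covariance. For the term in [|u - s|^p],
    writing [e^{-theta u}] as [e^{-theta s} e^{-theta (u - s)}] produces [E (u - s)]. *)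
Definition cov_primitive t s u : R :=
  2^-1 * (- expR (theta * t + - theta * u) * `|s| `^ p
          + theta * expR (theta * t) * E u
          - theta * expR (theta * t + - theta * s) * E (u - s)).

Lemma is_derive_cov_primitive t s u :
  is_derive u 1 (cov_primitive t s) (OU_kernel t u * fBm_cov p s u).
Proof.
have dEs : is_derive u 1 (fun u => E (u - s))
    (expR (- theta * (u - s)) * `|u - s| `^ p).
  rewrite -[X in is_derive _ _ _ X]mulr1 -[X in _ * X]subr0.
  by apply: is_derive_compf; apply: is_derive_subf.
have dexp := is_derive_expR_affine (theta * t) (- theta) u.
rewrite /cov_primitive; apply: is_derive_eq; rewrite /GRing.scale/=.
rewrite /OU_kernel /fBm_cov [`|s - u|]distrC.
have -> : expR (theta * t + - theta * u) =
    expR (theta * t) * expR (- theta * u) by rewrite expRD.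
have -> : expR (- theta * (u - s)) =
    expR (- theta * u) / expR (- theta * s).
  by rewrite mulrBr expRB.
rewrite expRD; set a := expR (- theta * s).
have : a != 0 by rewrite gt_eqF// expR_gt0.
by move=> a0; field.
Qed.

Definition cov_integral t s : R := cov_primitive t s t - cov_primitive t s 0.

Lemma cov_integralE t s : cov_integral t s =
  2^-1 * ((expR (theta * t) - 1) * `|s| `^ p + theta * expR (theta * t) * E t
    - theta * expR (theta * t + - theta * s) * (E (t - s) - E (- s))).
Proof.
rewrite /cov_integral /cov_primitive mulr0 addr0 -mulrBr.
rewrite (_ : theta * t + - theta * t = 0) ?expR0; last by ring.
by rewrite E0 sub0r; ring.
Qed.

(** Primitive in [s] of the kernel times [cov_integral]. The last term of [cov_integralE] is
    integrated by parts against [e^{-2 theta s}], and the remaining integrals are again values of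
    [E], at [s - t] and [s]. No division by [theta] occurs, so [theta = 0] is covered. *)
Definition var_primitive t s : R :=
  2^-1 * ((expR (theta * t) - 1) * theta * expR (theta * t) * E s
   - theta * expR (theta * t) ^+ 2 * E t * expR (0 + - theta * s)
   + 2^-1 * theta * expR (theta * t) ^+ 2 *
     (expR (0 + - (2 * theta) * s) * (E (t - s) - E (- s))
      + (expR (0 + - (2 * theta) * t) * E (s - t) - E s))).

Lemma is_derive_var_primitive t s :
  is_derive s 1 (var_primitive t) (OU_kernel t s * cov_integral t s).
Proof.
have d1 : is_derive s 1 (fun s => E (t - s))
    (expR (- theta * (t - s)) * `|t - s| `^ p * (0 - 1)).
  by apply: is_derive_compf; apply: is_derive_subf.
have d2 : is_derive s 1 (fun s => E (- s))
    (expR (- theta * (- s)) * `|- s| `^ p * (- 1)).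
  by apply: is_derive_compf; apply: is_deriveN.
have d3 : is_derive s 1 (fun s => E (s - t))
    (expR (- theta * (s - t)) * `|s - t| `^ p * (1 - 0)).
  by apply: is_derive_compf; apply: is_derive_subf.
have d4 := is_derive_expR_affine 0 (- theta) s.
have d5 := is_derive_expR_affine 0 (- (2 * theta)) s.
rewrite /var_primitive; apply: is_derive_eq; rewrite /GRing.scale/=.
rewrite cov_integralE /OU_kernel [`|t - s|]distrC normrN !add0r.
have -> : - (2 * theta) * s = - theta * s + - theta * s by ring.
have -> : - (2 * theta) * t = - (theta * t + theta * t) by ring.
have -> : - theta * (t - s) = - (theta * t) - (- theta * s) by ring.
have -> : - theta * - s = - (- theta * s) by ring.
have -> : - theta * (s - t) = theta * t + - theta * s by ring.
rewrite !(expRD, expRN).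
set a := expR (theta * t); set b := expR (- theta * s).
have a0 : a != 0 by rewrite gt_eqF// expR_gt0.
have b0 : b != 0 by rewrite gt_eqF// expR_gt0.
by field; rewrite a0 b0.
Qed.

(** The left side is the variance of [B_t] plus the integral of the kernel against [B]: the variance
    of [B_t], twice the covariance with the integral, and the double integral. *)
Lemma OU_varianceE t : 0 <= t -> fBm_cov p t t + 2 * cov_integral t t +
  (var_primitive t t - var_primitive t 0) = OU_variance t.
Proof.
move=> t0; rewrite fBm_cov_diag// cov_integralE /var_primitive /OU_variance.
rewrite ger0_norm// !subrr !mulr0 !addr0 !expR0 !add0r subr0 oppr0 E0.
have -> : - (2 * theta) * t = - (theta * t + theta * t) by ring.
have -> : - theta * t = - (theta * t) by ring.
rewrite !(expRD, expRN) sub0r; set a := expR (theta * t).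
have a0 : a != 0 by rewrite gt_eqF// expR_gt0.
by field.
Qed.

(** The inner sums converge to [cov_integral] uniformly over the outer variable, and the kernel is
    bounded, so the double sum has the same limit as the simple sum of the kernel times
    [cov_integral]. *)
Lemma cvg_riemann_variance t : 0 <= t ->
  (fBm_cov p t t
   + 2 * riemann_sum t n.+1 (fun s => OU_kernel t s * fBm_cov p t s)
   + riemann_sum t n.+1 (fun s => OU_kernel t s *
       riemann_sum t n.+1 (fun u => OU_kernel t u * fBm_cov p s u)))
    @[n --> \oo] --> OU_variance t.
Proof.
move=> t0; rewrite -OU_varianceE//.
pose K (z : R * R) : R := OU_kernel t z.2 * fBm_cov p z.1 z.2.
have cK : continuous K.
  move=> z; apply: cvgM; last exact: continuous_fBm_cov.
  apply: (cvg_comp _ (OU_kernel t)); first exact: cvg_snd.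
  exact: continuous_OU_kernel.
have cg : continuous (fun s => OU_kernel t s * cov_integral t s).
  move=> s; apply: cvgM; first exact: continuous_OU_kernel.
  rewrite (_ : cov_integral t = fun s =>
    2^-1 * ((expR (theta * t) - 1) * `|s| `^ p + theta * expR (theta * t) * E t
    - theta * expR (theta * t + - theta * s) * (E (t - s) - E (- s)))); last first.
    by apply/funext => x; exact: cov_integralE.
  apply: cvgM; first exact: cvg_cst.
  apply: cvgB; first apply: cvgD.
  - by apply: cvgM; [exact: cvg_cst|exact: continuous_normr_powR].
  - exact: cvg_cst.
  apply: cvgM; first exact: continuous_OU_kernel.
  apply: cvgB.
    apply: (cvg_comp (fun x => t - x) E); last exact: continuous_E.
    by apply: cvgB; [exact: cvg_cst|exact: cvg_id].
  apply: (cvg_comp (fun x => - x) E); last exact: continuous_E.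
  by apply: cvgN; exact: cvg_id.
apply: cvgD; first apply: cvgD; first exact: cvg_cst.
  apply: cvgM; first exact: cvg_cst.
  apply/cvgrPdist_le => e e0.
  have := riemann_sum_unif t0 cK (is_derive_cov_primitive t) e0.
  by apply: filterS => n /(_ t); rewrite lexx t0 distrC; exact.
apply: (cvg_riemann_sum_unif t0 _
  (cvg_riemann_sum t0 cg (is_derive_var_primitive t))).
(* [M] bounds the kernel on [[0, t]]; the added [1] keeps it positive when [theta = 0]. *)
move=> e e0; pose M := `|theta| * expR (`|theta| * t) + 1.
have M0 : 0 < M by rewrite ltr_wpDl// mulr_ge0// expR_ge0.
have phiM s : 0 <= s <= t -> `|OU_kernel t s| <= M.
  move=> /andP[s0 st]; rewrite /OU_kernel normrM (ger0_norm (expR_ge0 _)).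
  rewrite /M ler_wpDr// ler_wpM2l// ler_expR.
  rewrite (_ : theta * t + - theta * s = theta * (t - s)); last by ring.
  rewrite (le_trans (ler_norm _))// normrM ler_wpM2l// ger0_norm; lra.
have eM : 0 < e / M by rewrite divr_gt0.
have := riemann_sum_unif t0 cK (is_derive_cov_primitive t) eM.
apply: filterS => n H s st; rewrite -mulrBr normrM.
rewrite (le_trans (ler_pM _ _ (phiM _ st) (H _ st)))//.
by rewrite mulrCA mulfV ?mulr1// gt_eqF.
Qed.

End variance.

(** * The fundamental theorem for an integrand singular at the left endpoint *)

Section singular_FTC.
Context {R : realType}.
Notation mu := (@lebesgue_measure R).

(** Apply the fundamental theorem on [[a n, b]] and let [a n] decrease to [0]: the integrals
    converge by monotone convergence, the increments of [F] by continuity. This serves [s^{2H - 1}],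
    which is unbounded near [0] when [H < 1/2]. *)
Lemma ge0_FTC_obnd (f F : R -> R) (b : R) : 0 < b -> measurable_fun setT f ->
  (forall x, 0 < x -> 0 <= f x) -> {in `]0, +oo[, continuous f} ->
  continuous F -> (forall x : R, 0 < x -> is_derive x 1 F (f x)) ->
  (\int[mu]_(x in `[0%R, b]) (f x)%:E = (F b - F 0)%:E)%E.
Proof.
move=> b0 mf f0 cf cF dF.
(* The denominator [n + 2] makes [a n < b] hold already at [n = 0]. *)
pose a (n : nat) : R := b / n.+2%:R.
have a0 n : 0 < a n by rewrite divr_gt0.
have ab n : a n < b by rewrite ltr_pdivrMr// ltr_pMr// ltr1n.
have mfE D : measurable_fun D (EFin \o f).
  by apply: measurable_funTS; exact/measurable_EFinP.
rewrite -integral_itv_obnd_cbnd//.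
pose A n : set R := `[a n, b]%classic.
have UA : \bigcup_n A n = `]0, b]%classic.
  apply/seteqP; split => x /=.
    move=> [n _]; rewrite /A/= in_itv/= => /andP[ax xb].
    by rewrite in_itv/= xb (lt_le_trans (a0 n) ax).
  rewrite in_itv/= => /andP[x0 xb].
  have [n _ H] := near_mesh b x0; exists n => //.
  rewrite /A/= in_itv/= xb andbT /a ltW//.
  exact: (H n.+1 (leqnSn n)).
have : (\int[mu]_(x in A n) (f x)%:E @[n --> \oo] -->
    \int[mu]_(x in \bigcup_n A n) (f x)%:E)%E.
  apply: ge0_nondecreasing_set_cvg_integral.
  - apply/nondecreasing_seqP => n; rewrite subsetEset => x.
    rewrite /A/= !in_itv/= => /andP[ax ->]; rewrite andbT (le_trans _ ax)//.
    by rewrite /a ler_wpM2l ?(ltW b0)// lef_pV2 ?posrE// ler_nat.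
  - by move=> n; exact: measurable_itv.
  - by move=> n; exact: mfE.
  - move=> n x; rewrite /A/= in_itv/= => /andP[ax _]; rewrite lee_fin f0//.
    exact: lt_le_trans (a0 n) ax.
rewrite UA => cvgA.
have FTC n : (\int[mu]_(x in A n) (f x)%:E = (F b - F (a n))%:E)%E.
  rewrite /A (@continuous_FTC2 _ _ F)//.
  - apply: continuous_in_subspaceT => x.
    rewrite inE/= in_itv/= => /andP[ax _].
    by apply: cf; rewrite in_itv/= andbT (lt_le_trans (a0 n) ax).
  - split.
    + move=> x; rewrite in_itv/= => /andP[ax _].
      by case: (dF x (lt_trans (a0 n) ax)).
    + by apply: cvg_at_right_filter; exact: cF.
    + by apply: cvg_at_left_filter; exact: cF.
  - move=> x; rewrite in_itv/= => /andP[ax _].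
    by rewrite derive1E; case: (dF x (lt_trans (a0 n) ax)).
have cvgF : ((F b - F (a n))%:E @[n --> \oo] --> (F b - F 0)%:E)%E.
  apply: cvg_EFin; first exact: nearW.
  apply: cvgB; first exact: cvg_cst.
  apply: (cvg_comp a F); last exact: cF.
  rewrite -(mulr0 b); apply: cvgM; first exact: cvg_cst.
  by have := @cvg_harmonic R; rewrite -(cvg_shiftS (harmonic : nat -> R)).
by move: cvgA; rewrite (funext FTC) => cvgA; exact: cvg_unique cvgA cvgF.
Qed.

Lemma ge0_FTC_obnd_integrable (f F : R -> R) (b : R) : 0 < b ->
  measurable_fun setT f ->
  (forall x, 0 <= x -> 0 <= f x) -> {in `]0, +oo[, continuous f} ->
  continuous F -> (forall x : R, 0 < x -> is_derive x 1 F (f x)) ->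
  mu.-integrable `[0, b] (EFin \o f) /\ \int[mu]_(x in `[0, b]) f x = F b - F 0.
Proof.
move=> b0 mf f0 cf cF dF.
have I := ge0_FTC_obnd b0 mf (fun x x0 => f0 x (ltW x0)) cf cF dF.
split; last by rewrite /Rintegral I.
apply/integrableP; split.
  by apply: measurable_funTS; exact/measurable_EFinP.
rewrite (_ : (\int[mu]_(x in `[0%R, b]) _)%E =
  (\int[mu]_(x in `[0%R, b]) (f x)%:E)%E); last first.
  apply: eq_integral => x; rewrite inE/= in_itv/= => /andP[x0 _].
  by rewrite ger0_norm// f0.
by rewrite I ltry.
Qed.

End singular_FTC.

(** * The integral [vOU]: closed form and dependence on [theta] *)

Section OU_variance_integral.
Context {R : realType}.
Notation mu := (@lebesgue_measure R).
Implicit Types (H theta t s : R).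

Definition vOU_integrand H theta t s : R :=
  s `^ (2 * H - 1) * (expR (theta * s) + expR (theta * (2 * t - s))).

Lemma vOU_integrand_ge0 H theta t s : 0 <= vOU_integrand H theta t s.
Proof. by rewrite mulr_ge0 ?powR_ge0// addr_ge0// expR_ge0. Qed.

(** [W] comes from integrating [H s^{2H - 1} e(s)] by parts: the boundary term is [s^{2H} e(s) / 2],
    and the two exponentials in [e'] give the terms in [E (- s)] and [E s]. *)
Lemma vOU_integral H theta t (E : R -> R) : 0 < H -> 0 < t ->
  (forall x : R, is_derive x 1 E (expR (- theta * x) * `|x| `^ (2 * H))) ->
  E 0 = 0 ->
  mu.-integrable `[0, t] (EFin \o vOU_integrand H theta t) /\
  vOU H theta t = OU_variance (2 * H) theta E t.
Proof.
move=> H0 t0 dE E0.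
have H20 : 0 < 2 * H by rewrite mulr_gt0.
have cE : continuous E by move=> x; exact: is_derive_continuous (dE x).
pose e (s : R) : R := expR (0 + theta * s) + expR (theta * (2 * t) + - theta * s).
pose W (s : R) : R := 2^-1 * (`|s| `^ (2 * H) * e s + theta * E (- s)
   + theta * expR (theta * (2 * t)) * E s).
have de (s : R) : is_derive s 1 e
    (theta * expR (0 + theta * s) + - theta * expR (theta * (2 * t) + - theta * s)).
  by apply: is_derive_addf; exact: is_derive_expR_affine.
have eE s : expR (theta * s) + expR (theta * (2 * t - s)) = e s.
  by rewrite /e add0r mulrBr mulNr.
have fE s : vOU_integrand H theta t s = s `^ (2 * H - 1) * e s.
  by rewrite /vOU_integrand eE.
have cW : continuous W.
  move=> s; apply: cvgM; first exact: cvg_cst.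
  apply: cvgD; first apply: cvgD.
  - apply: cvgM; first exact: continuous_normr_powR.
    exact: is_derive_continuous (de s).
  - apply: cvgM; first exact: cvg_cst.
    apply: (cvg_comp (fun x => - x) E); last exact: cE.
    by apply: cvgN; exact: cvg_id.
  - by apply: cvgM; [exact: cvg_cst|exact: cE].
have dW (s : R) : 0 < s -> is_derive s 1 W (H * vOU_integrand H theta t s).
  move=> s0; have d1 := is_derive_normr_powR (2 * H) s0.
  have d2 : is_derive s 1 (fun s => E (- s))
      (expR (- theta * (- s)) * `|- s| `^ (2 * H) * (- 1)).
    by apply: is_derive_compf; apply: is_deriveN.
  rewrite fE /W; apply: is_derive_eq; rewrite /GRing.scale/=.
  have -> : - theta * - s = theta * s by ring.
  by rewrite normrN (gtr0_norm s0) /e add0r expRD; field.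
have mf : measurable_fun setT (vOU_integrand H theta t).
  apply: measurable_funM; first exact: measurable_powR.
  rewrite (_ : (fun _ => _) = e); last by apply/funext => s; rewrite eE.
  apply: continuous_measurable_fun => s.
  exact: is_derive_continuous (de s).
have cf : {in `]0, +oo[, continuous (vOU_integrand H theta t)}.
  move=> s; rewrite in_itv/= andbT => s0.
  rewrite (_ : vOU_integrand H theta t = fun s => s `^ (2 * H - 1) * e s); last first.
    by apply/funext => x; rewrite fE.
  apply: cvgM; last exact: is_derive_continuous (de s).
  exact: is_derive_continuous (is_derive1_powR _ s0).
have Hf0 : H != 0 by rewrite gt_eqF.
have [||||fint fI] := @ge0_FTC_obnd_integrable _ (vOU_integrand H theta t)
    (fun s => H^-1 * W s) t t0 mf.
- by move=> x _; exact: vOU_integrand_ge0.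
- exact: cf.
- by move=> x; apply: cvgM; [exact: cvg_cst|exact: cW].
- move=> x x0; rewrite -[X in is_derive _ _ _ X](mulKf Hf0).
  by apply: is_derive_mulcf; exact: dW.
split=> //; rewrite /vOU -/(vOU_integrand H theta t) fI -mulrBr mulVKf//.
rewrite /W /OU_variance normr0 powR0 ?gt_eqF// oppr0 E0 (gtr0_norm t0) /e.
rewrite !(mulr0, mul0r, addr0, add0r, subr0).
have -> : theta * (2 * t) = theta * t + theta * t by ring.
have -> : theta * t + theta * t + - theta * t = theta * t by ring.
by rewrite expRD; field.
Qed.

Lemma OU_primitive (p theta : R) : 0 < p -> exists2 E : R -> R,
  forall x : R, is_derive x 1 E (expR (- theta * x) * `|x| `^ p) & E 0 = 0.
Proof.
move=> p0.
have [x|F dF] := @continuous_antiderivative R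
    (fun x => expR (- theta * x) * `|x| `^ p).
  apply: cvgM; last exact: continuous_normr_powR.
  have := is_derive_expR_affine 0 (- theta) x => /is_derive_continuous.
  rewrite (_ : (fun y => expR (0 + - theta * y)) = (fun y => expR (- theta * y)))//.
  by apply/funext => y; rewrite add0r.
exists (fun x => F x - F 0) => [x|]; last by rewrite subrr.
rewrite -[X in is_derive _ _ _ X]subr0.
by apply: is_derive_subf; exact: dF.
Qed.

Lemma vOU_integrable H theta t : 0 < H -> 0 < t ->
  mu.-integrable `[0, t] (EFin \o vOU_integrand H theta t).
Proof.
move=> H0 t0; have [|E dE E0] := @OU_primitive (2 * H) theta.
  by rewrite mulr_gt0.
by have [] := vOU_integral H0 t0 dE E0.
Qed.

Lemma vOU0 H t : 0 < H -> 0 < t -> vOU H 0 t = t `^ (2 * H).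
Proof.
move=> H0 t0; have [|E dE E0] := @OU_primitive (2 * H) 0.
  by rewrite mulr_gt0.
have [_ ->] := vOU_integral H0 t0 dE E0.
by rewrite /OU_variance mul0r expR0 mulr0 !mul0r mul1r addr0.
Qed.

(** Strictness of the integral comes from a gap: the integrand grows by at least [c] times the
    integrand at drift [0], whose integral is positive by [vOU0]. *)
Lemma lt_vOU H theta1 theta2 t : 0 < H -> 0 < t -> theta1 < theta2 ->
  vOU H theta1 t < vOU H theta2 t.
Proof.
move=> H0 t0 th12; rewrite /vOU ltr_pM2l//.
(* With [u = 2t - s >= t], [e^{theta2 u} >= e^{theta1 u} (1 + (theta2 - theta1) u)] and
   [e^{theta1 u} >= e^{-2 |theta1| t}]. The factor [2^-1] cancels the [1 + 1] in the integrand at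
   drift [0]. *)
pose c := 2^-1 * ((theta2 - theta1) * t * expR (- (`|theta1| * (2 * t)))).
have c0 : 0 < c by rewrite !mulr_gt0 ?expR_gt0 ?subr_gt0.
apply: (@lt_le_trans _ _ (\int[mu]_(s in `[0, t])
    (vOU_integrand H theta1 t s + c * vOU_integrand H 0 t s))).
  rewrite RintegralD//; last 2 first.
  - exact: vOU_integrable.
  - rewrite (_ : _ \o _ = fun s => c%:E * (vOU_integrand H 0 t s)%:E)%E; last first.
      by apply/funext => s; rewrite /= EFinM.
    by apply: integrableZl => //; exact: vOU_integrable.
  rewrite ltrDl RintegralZl//; last exact: vOU_integrable.
  rewrite mulr_gt0// -(pmulr_rgt0 _ H0).
  by have := vOU0 H0 t0; rewrite /vOU => ->; rewrite powR_gt0.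
apply: le_Rintegral => //.
- rewrite (_ : _ \o _ = (EFin \o vOU_integrand H theta1 t) \+
      (fun s => c%:E * (vOU_integrand H 0 t s)%:E))%E; last first.
    by apply/funext => s; rewrite /= EFinD EFinM.
  apply: integrableD => //; first exact: vOU_integrable.
  by apply: integrableZl => //; exact: vOU_integrable.
- exact: vOU_integrable.
move=> s /=; rewrite in_itv/= => /andP[s0 st].
rewrite /vOU_integrand mulrCA -mulrDr ler_wpM2l ?powR_ge0//.
rewrite !mul0r expR0 -addrA lerD//; first by rewrite ler_expR ler_wpM2r// ltW.
rewrite (_ : c * (1 + 1) =
    expR (- (`|theta1| * (2 * t))) * ((theta2 - theta1) * t)); last first.
  by rewrite /c; field.
rewrite (_ : theta2 * (2 * t - s) = theta1 * (2 * t - s) +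
    (theta2 - theta1) * (2 * t - s)); last by ring.
rewrite expRD.
apply: (@le_trans _ _ (expR (theta1 * (2 * t - s)) *
  (1 + (theta2 - theta1) * (2 * t - s)))); last first.
  by rewrite ler_wpM2l ?expR_ge0// expR_ge1Dx.
rewrite [leRHS]mulrDr mulr1 lerD2l ler_pM ?expR_ge0//.
- by rewrite mulr_ge0 ?ltW// subr_gt0.
- have h1 : 0 <= (theta1 + `|theta1|) * (2 * t - s).
    by rewrite mulr_ge0//; [have := ler_norm (- theta1); rewrite normrN|]; lra.
  have h2 : 0 <= `|theta1| * s by rewrite mulr_ge0.
  by rewrite ler_expR; lra.
- by rewrite ler_wpM2l ?subr_ge0 ?(ltW th12)//; lra.
Qed.

(** It strictly exceeds its value at [theta - 1], which is nonnegative. *)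
Lemma vOU_gt0 H theta t : 0 < H -> 0 < t -> 0 < vOU H theta t.
Proof.
move=> H0 t0; apply: le_lt_trans (@lt_vOU H (theta - 1) theta t H0 t0 _).
  rewrite mulr_ge0 ?(ltW H0)//; apply: Rintegral_ge0 => s _.
  exact: vOU_integrand_ge0.
lra.
Qed.

(** Both exponents, [s] and [2t - s], are at most [2t], so the bound holds pointwise. *)
Lemma le_vOU_scale H theta1 theta2 t : 0 < H -> 0 < t -> theta1 <= theta2 ->
  vOU H theta2 t <= expR ((theta2 - theta1) * (2 * t)) * vOU H theta1 t.
Proof.
move=> H0 t0 th12; rewrite /vOU mulrCA ler_wpM2l ?(ltW H0)//.
rewrite -RintegralZl//; last exact: vOU_integrable.
apply: le_Rintegral => //.
- exact: vOU_integrable.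
- rewrite (_ : _ \o _ = fun s => (expR ((theta2 - theta1) * (2 * t)))%:E *
      (vOU_integrand H theta1 t s)%:E)%E; last first.
    by apply/funext => s; rewrite /= EFinM.
  by apply: integrableZl => //; exact: vOU_integrable.
move=> s /=; rewrite in_itv/= => /andP[s0 st].
rewrite mulrCA ler_wpM2l ?powR_ge0// [leRHS]mulrDr.
have d0 : 0 <= theta2 - theta1 by rewrite subr_ge0.
have H1 u : u <= 2 * t -> theta2 * u <= (theta2 - theta1) * (2 * t) + theta1 * u.
  by move=> ut; rewrite -lerBlDr -mulrBl ler_wpM2l.
by rewrite -!expRD lerD// ler_expR H1//; lra.
Qed.

End OU_variance_integral.

(** * Pathwise solution of the linear equation *)

Section OU_path.
Context {R : realType}.
Notation mu := (@lebesgue_measure R).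

(** With [I] the integral of [x], the function [K u = e^{theta (t - u)} (x0 + theta I u) - G u] has
    zero derivative inside [[0, t]] by the equation; comparing [K t] with [K 0] gives the
    formula. *)
Lemma OU_path (theta x0 t : R) (x b G : R -> R) : 0 < t ->
  (forall u : R, 0 <= u -> mu.-integrable `[0, u] (EFin \o x) /\
    x u = x0 + theta * (\int[mu]_(s in `[0, u]) x s) + b u) ->
  continuous b ->
  (forall s : R, is_derive s 1 G (OU_kernel theta t s * b s)) ->
  x t - x0 * expR (theta * t) = b t + (G t - G 0).
Proof.
move=> t0 xE cb dG.
have intx := (xE t (ltW t0)).1.
pose I (u : R) : R := \int[mu]_(s in `[0, u]) x s.
have cI : {within `[0, t], continuous I}.
  exact: parameterized_integral_continuous (ltW t0) intx.
have [cIo _ _] := (continuous_within_itvP I t0).1 cI.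
have dI (u : R) : 0 < u -> u < t -> is_derive u 1 I (x u).
  (* The path [x] inherits continuity at [u] from the right side of its own equation, so [I] is
     differentiable there. *)
  move=> u0 ut; have cx : {for u, continuous x}.
    have cy : (x0 + theta * I v + b v) @[v --> u] --> x u.
      rewrite (xE u (ltW u0)).2; apply: cvgD; last exact: cb.
      apply: cvgD; first exact: cvg_cst.
      by apply: cvgM; [exact: cvg_cst|apply: cIo; rewrite in_itv/= u0 ut].
    apply: cvg_trans cy; apply: near_eq_cvg; near=> v.
    rewrite -(xE v _).2// ltW//; near: v; exact: lt_nbhsr.
  have [dI IE] := continuous_FTC1_closed ut intx u0 cx.
  by apply: DeriveDef; [exact: dI|rewrite -derive1E].
pose K (u : R) : R := expR (theta * t + - theta * u) * (x0 + theta * I u) - G u.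
have cG : continuous G by move=> s; exact: is_derive_continuous (dG s).
have [||c _] := @MVT_within R K (fun=> 0) 0 t (ltW t0).
- move=> u u0 ut; have d1 := dI u u0 ut; have d2 := dG u.
  have d3 := is_derive_expR_affine (theta * t) (- theta) u.
  rewrite /K; apply: is_derive_eq; rewrite /GRing.scale/=.
  have -> : b u = x u - x0 - theta * I u.
    by rewrite (xE u (ltW u0)).2 -/(I u); ring.
  by rewrite /OU_kernel; ring.
- move/subspace_continuousP in cI; apply/subspace_continuousP => u ut.
  have cGu : G v @[v --> within `[0, t] (nbhs u)] --> G u.
    by apply: cvg_within_filter; exact: cG.
  have ceu : expR (theta * t + - theta * v) @[v --> within `[0, t] (nbhs u)] -->
      expR (theta * t + - theta * u).
    apply: cvg_within_filter.
    exact: is_derive_continuous (is_derive_expR_affine (theta * t) (- theta) u).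
  have cIu : I v @[v --> within `[0, t] (nbhs u)] --> I u by exact: cI.
  apply: cvgB => //; apply: cvgM => //; apply: cvgD; first exact: cvg_cst.
  by apply: cvgM => //; exact: cvg_cst.
rewrite mul0r /K mulr0 addr0.
rewrite (_ : theta * t + - theta * t = 0); last by ring.
rewrite expR0 mul1r [I 0]/I set_itv1 Rintegral_set1 mulr0 addr0.
rewrite (xE t (ltW t0)).2 -/(I t) [expR _ * x0]mulrC; lra.
Unshelve. all: end_near. Qed.

Lemma OU_path_cvg (theta x0 t : R) (x b : R -> R) : 0 < t ->
  (forall u : R, 0 <= u -> mu.-integrable `[0, u] (EFin \o x) /\
    x u = x0 + theta * (\int[mu]_(s in `[0, u]) x s) + b u) ->
  continuous b ->
  b t + riemann_sum t n.+1 (fun s => OU_kernel theta t s * b s) @[n --> \oo]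
    --> x t - x0 * expR (theta * t).
Proof.
move=> t0 xE cb.
have cf : continuous (fun s => OU_kernel theta t s * b s).
  by move=> s; apply: cvgM; [exact: continuous_OU_kernel|exact: cb].
have [G dG] := continuous_antiderivative cf.
rewrite (OU_path t0 xE cb dG); apply: cvgD; first exact: cvg_cst.
exact: cvg_riemann_sum (ltW t0) cf dG.
Qed.

End OU_path.

(* The library equips [R] and [measurableTypeR R] with Borel structures of
   different displays; this identity transports random variables and measures
   from one to the other. *)
Definition idTR (R : realType) : measurableTypeR R -> R := idfun.

HB.instance Definition _ (R : realType) :=
  @isMeasurableFun.Build _ _ _ _ (@idTR R) (@measurable_id _ _ setT).

(** * The normal distribution function: derivative, scaling, symmetry *)

Section standard_normal.
Context {R : realType}.
Notation mu := (@lebesgue_measure R).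
Implicit Types (m s x : R).

Definition normal_cdf s x : R := fine (normal_prob 0 s `]-oo, x]%classic).

Lemma normal_cdf1 : normal_cdf 1 = @Phi R.
Proof. by []. Qed.

Lemma normal_cdfK s x : (normal_cdf s x)%:E = normal_prob 0 s `]-oo, x]%classic.
Proof. by rewrite /normal_cdf fineK// fin_num_measure. Qed.

Lemma is_derive_normal_cdf s x : s != 0 ->
  is_derive x 1 (normal_cdf s) (normal_pdf 0 s x).
Proof.
move=> s0; have xu : x < x + 1 by rewrite ltrDl.
have intf : mu.-integrable `]-oo, (x + 1)] (EFin \o normal_pdf 0 s).
  by apply: integrableS (integrable_normal_pdf 0 s).
have [|d dE] := continuous_FTC1 xu intf _ (continuous_normal_pdf s0 (x := x)).
  by rewrite /= ltNyr.
by apply: DeriveDef; [exact: d|rewrite -derive1E].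
Qed.

Lemma cvg_normal_cdfNy s : normal_cdf s x @[x --> -oo] --> (0 : R).
Proof.
have := @cvg_cdfNy0 _ _ R (normal_prob 0 s) (@idTR R).
by move=> /fine_cvgP[].
Qed.

Lemma cvg_normal_cdfy s : normal_cdf s x @[x --> +oo] --> (1 : R).
Proof.
have := @cvg_cdfy1 _ _ R (normal_prob 0 s) (@idTR R).
by move=> /fine_cvgP[].
Qed.

Lemma normal_pdf_scale m s x : 0 < s ->
  normal_pdf m s (m + s * x) * s = normal_pdf 0 1 x.
Proof.
move=> s0; rewrite !normal_pdfE ?gt_eqF// /normal_peak /normal_fun subr0.
rewrite expr1n mul1r -[s ^+ 2 * pi *+ 2]mulrnAr sqrtrM ?sqr_ge0//.
have s1 : s != 0 by rewrite gt_eqF.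
have pi1 : Num.sqrt (pi *+ 2) != 0 :> R.
  by rewrite gt_eqF// sqrtr_gt0 mulrn_wgt0// pi_gt0.
rewrite sqrtr_sqr gtr0_norm// (addrC m) addrK.
have -> : - (s * x) ^+ 2 / (s ^+ 2 *+ 2) = - x ^+ 2 / 2 by field.
by field; rewrite pi1 s1.
Qed.

Lemma normal_pdf_even x : normal_pdf 0 1 (- x) = normal_pdf 0 1 x :> R.
Proof.
by rewrite !normal_pdfE ?oner_neq0// /normal_fun !subr0 sqrrN.
Qed.

Lemma is_derive_normal_pdf x :
  is_derive x 1 (normal_pdf 0 1 : R -> R) (- x * normal_pdf 0 1 x).
Proof.
have n0 : (1 : R) != 0 by exact: oner_neq0.
have E : normal_pdf 0 1 = fun x : R => normal_peak 1 * expR (- 2^-1 * x ^+ 2).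
  apply/funext => y; rewrite normal_pdfE// /normal_fun subr0; congr (_ * expR _).
  by rewrite expr1n; field.
rewrite E; apply: is_derive_eq; rewrite /GRing.scale/=.
by field.
Qed.

(** Both sides have derivative [normal_pdf 0 s], so they differ by a constant, and both vanish at
    [-oo]. *)
Lemma normal_cdf_scale s x : 0 < s -> normal_cdf s x = Phi (x / s).
Proof.
move=> s0; have s1 : s != 0 by rewrite gt_eqF.
have dPhi (y : R) : is_derive y 1 (fun y => Phi (y / s)) (normal_pdf 0 s y).
  have d1 := is_derive_normal_cdf (y / s) (oner_neq0 R).
  have -> : normal_pdf 0 s y = normal_pdf 0 1 (y / s) * s^-1.
    by rewrite -(normal_pdf_scale 0 (y / s) s0) add0r [s * _]mulrC divfK// mulfK.
  apply: is_derive_compf => //; rewrite (_ : (fun z => z / s) = fun z => 0 + s^-1 * z).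
    exact: is_derive_affine.
  by apply/funext => z; rewrite add0r mulrC.
have H y : normal_cdf s x - Phi (x / s) = normal_cdf s y - Phi (y / s).
  have := eq_of_is_derive_eq (fun z => is_derive_normal_cdf z s1) dPhi x y.
  lra.
apply/eqP; rewrite -subr_eq0; apply/eqP.
have c0 : (normal_cdf s y - Phi (y / s)) @[y --> -oo] --> (0 - 0 : R).
  apply: cvgB; first exact: cvg_normal_cdfNy.
  apply: (cvg_comp (fun y => y / s) (@Phi R)); last first.
    exact: (cvg_normal_cdfNy 1).
  by apply: gt0_cvgMlNy; [rewrite invr_gt0|exact: cvg_id].
rewrite subr0 in c0; apply: cvg_unique c0 => //.
rewrite (_ : (fun y => _) = cst (normal_cdf s x - Phi (x / s))).
  exact: cvg_cst.
by apply/funext => y; rewrite -H.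
Qed.

(** [Phi x + Phi (- x)] is constant because the density is even; its limit at [-oo] is [1]. *)
Lemma PhiN x : Phi (- x) = 1 - Phi x.
Proof.
have dPhiN (y : R) : is_derive y 1 (fun y => - Phi (- y)) (normal_pdf 0 1 y).
  have d1 := is_derive_normal_cdf (- y) (oner_neq0 R).
  rewrite normal_cdf1 in d1; apply: is_derive_eq.
  by rewrite normal_pdf_even; lra.
have H y : Phi x + Phi (- x) = Phi y + Phi (- y).
  have := eq_of_is_derive_eq (fun z => is_derive_normal_cdf z (oner_neq0 R))
    dPhiN x y.
  by rewrite normal_cdf1; lra.
have c1 : (Phi y + Phi (- y)) @[y --> -oo] --> (0 + 1 : R).
  apply: cvgD; first exact: (cvg_normal_cdfNy 1).
  apply: (cvg_comp (fun y => - y) (@Phi R)); last exact: (cvg_normal_cdfy 1).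
  by rewrite ninftyN.
suff: Phi x + Phi (- x) = 1 by lra.
rewrite add0r in c1; apply: cvg_unique c1 => //.
rewrite (_ : (fun y => _) = cst (Phi x + Phi (- x))); first exact: cvg_cst.
by apply/funext => y; rewrite -H.
Qed.

End standard_normal.

(** * Integration against the normal density *)

Section normal_moments.
Context {R : realType}.
Notation mu := (@lebesgue_measure R).
Implicit Types (m s x : R).
Local Notation phi := (@normal_pdf R 0 1).

Lemma normal_pdfN m s x : normal_pdf m (- s) x = normal_pdf m s x.
Proof. by rewrite /normal_pdf oppr_eq0 /normal_peak /normal_fun sqrrN. Qed.

Lemma normal_pdf_norm m s : normal_pdf m `|s| = normal_pdf m s.
Proof.
have [s0|s0] := leP 0 s; first by rewrite ger0_norm.
by apply/funext => x; rewrite ltr0_norm// normal_pdfN.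
Qed.

(** The Radon-Nikodym derivative and [normal_pdf] have the same integral over every measurable set,
    hence agree almost everywhere. *)
Lemma integral_normal_prob m s (f : R -> \bar R) : s != 0 ->
  measurable_fun setT f ->
  (\int[normal_prob m s]_x `|f x| < +oo)%E ->
  (\int[normal_prob m s]_x f x = \int[mu]_x (f x * (normal_pdf m s x)%:E))%E.
Proof.
move=> s0 mf finf.
have dom := @normal_prob_dominates R m s.
rewrite -(Radon_Nikodym_change_of_variables dom)//=; last first.
  by apply/integrableP; split.
apply: ae_eq_integral => //.
- apply: emeasurable_funM => //; exact: (measurable_int mu).
- apply: emeasurable_funM => //; apply/measurableT_comp => //.
  exact: measurable_normal_pdf.
- apply: ae_eqe_mul2l => /=; rewrite Radon_NikodymE/=.
  case: cid => /= h [h1 h2 h3].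
  apply: integral_ae_eq => //=.
  + by apply/measurableT_comp => //; exact: measurable_normal_pdf.
  + by move=> E E01 mE; rewrite -h3.
Qed.

Lemma integral_normal_pdf_scale m s (g : R -> R) : 0 < s -> continuous g ->
  (forall x, 0 <= g x) ->
  (\int[mu]_x (g x * normal_pdf m s x)%:E =
   \int[mu]_x (g (m + s * x)%R * phi x)%:E)%E.
Proof.
move=> s0 cg g0; pose F (x : R) : R := m + s * x.
have dF (x : R) : is_derive x 1 F s by exact: is_derive_affine.
have F'E : F^`()%classic = cst s.
  by apply/funext => x; rewrite derive1E; apply: derive_val.
rewrite (@increasing_ge0_integration_by_substitutionT R F)//.
- apply: eq_integral => x _; rewrite F'E /=; congr (_%:E).
  by rewrite -[LHS]mulrA /F normal_pdf_scale.
- by move=> x y xy; rewrite ltrD2l ltr_pM2l.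
- by rewrite F'E => ?; exact: cvg_cst.
- by rewrite F'E; exact: is_cvg_cst.
- by rewrite F'E; exact: is_cvg_cst.
- apply: (cvg_comp (fun x => s * x) (fun y => m + y)); last exact: cvg_addrl_Ny.
  by apply: gt0_cvgMrNy => //; exact: cvg_id.
- apply: (cvg_comp (fun x => s * x) (fun y => m + y)); last exact: cvg_addrl.
  by apply: gt0_cvgMry => //; exact: cvg_id.
- move=> x; apply: cvgM; first exact: cg.
  by apply: continuous_normal_pdf; rewrite gt_eqF.
- by move=> x; rewrite mulr_ge0// normal_pdf_ge0.
Qed.

Lemma continuous_phi : continuous phi.
Proof. by apply: continuous_normal_pdf; exact: oner_neq0. Qed.

(** From [e^{x^2 / 2} >= 1 + x^2 / 2] the product is at most a constant over [x]. *)
Lemma cvg_id_normal_pdf : x * phi x @[x --> +oo] --> (0 : R).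
Proof.
have c0 : (fun x => 2 * normal_peak 1 * x^-1) @ +oo --> (0 : R).
  rewrite -[X in _ --> X](mulr0 (2 * normal_peak 1)).
  apply: cvgM; first exact: cvg_cst.
  by apply/gtr0_cvgV0; [exact: nbhs_pinfty_gt|exact: cvg_id].
apply: squeeze_cvgr (cvg_cst 0) c0; near=> x.
have x0 : 0 < x by near: x; exact: nbhs_pinfty_gt.
rewrite mulr_ge0 ?(ltW x0) ?normal_pdf_ge0//= normal_pdfE ?oner_neq0//.
rewrite mulrCA [2 * _]mulrC -mulrA ler_wpM2l ?normal_peak_ge0//.
rewrite /normal_fun subr0 expr1n mulNr expRN ler_pdivrMr ?expR_gt0//.
apply: (@le_trans _ _ (2 * x^-1 * (1 + x ^+ 2 / 2))); last first.
  by rewrite ler_wpM2l ?expR_ge1Dx// mulr_ge0// invr_ge0 ltW.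
rewrite (_ : 2 * x^-1 * (1 + x ^+ 2 / 2) = x + 2 * x^-1); last first.
  by field; rewrite gt_eqF.
by rewrite lerDl mulr_ge0// invr_ge0 ltW.
Unshelve. all: end_near. Qed.

Lemma Phi0 : Phi (0 : R) = 2^-1.
Proof. by have := PhiN (0 : R); rewrite oppr0; lra. Qed.

Lemma integral_sqr_normal_pdf : (\int[mu]_x (x ^+ 2 * phi x)%:E = 1)%E.
Proof.
have cf : continuous (fun x : R => x ^+ 2 * phi x).
  move=> x; apply: cvgM; last exact: continuous_phi.
  exact: sqr_continuous.
(* [phi' x = - x * phi x], so [Phi x - x * phi x] is a primitive of [x^2 * phi x]. *)
have dF (x : R) : is_derive x 1 (fun x => Phi x - x * phi x) (x ^+ 2 * phi x).
  have d1 := is_derive_normal_cdf x (oner_neq0 R).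
  rewrite normal_cdf1 in d1; have d2 := is_derive_normal_pdf x.
  by apply: is_derive_eq; rewrite /GRing.scale/=; ring.
rewrite ge0_symfun_integralT//; last 2 first.
- by move=> x; rewrite mulr_ge0 ?sqr_ge0 ?normal_pdf_ge0.
- by move=> x /=; rewrite sqrrN normal_pdf_even.
rewrite -set_itvcy (@ge0_continuous_FTC2y R _ (fun x => Phi x - x * phi x) 0 1)//.
- by rewrite mul0r subr0 Phi0 -EFinB -EFinM; congr (_%:E); lra.
- by move=> x _; rewrite mulr_ge0 ?sqr_ge0 ?normal_pdf_ge0.
- exact: continuous_subspaceT.
- rewrite -[X in _ --> X]subr0; apply: cvgB; first exact: (cvg_normal_cdfy 1).
  exact: cvg_id_normal_pdf.
- by apply: cvg_at_right_filter; exact: is_derive_continuous (dF 0).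
- by move=> x _; rewrite derive1E; apply: derive_val.
Qed.

(** Splitting the line at [0] and reflecting the negative half makes the two sides equal up to the
    order of the halves. *)
Lemma ge0_integral_oppr (G : R -> R) : continuous G -> (forall x, 0 <= G x) ->
  (\int[mu]_x (G x)%:E = \int[mu]_x (G (- x)%R)%:E)%E.
Proof.
have split_integral (g : R -> R) : continuous g -> (forall x, 0 <= g x) ->
    (\int[mu]_x (g x)%:E = \int[mu]_(x in `[0%R, +oo[) (g (- x)%R)%:E
      + \int[mu]_(x in `[0%R, +oo[) (g x)%:E)%E.
  move=> cg g0.
  have mg (D : set (measurableTypeR R)) : measurable_fun D (EFin \o g).
    by apply/measurable_EFinP/measurable_funTS; exact: continuous_measurable_fun.
  have /= <- := @ge0_integration_by_substitutionNy R g 0; last 2 first.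
  - exact: continuous_subspaceT.
  - by move=> x _; exact: g0.
  rewrite oppr0 -[X in (_ = _ + X)%E]integral_itv_obnd_cbnd//; last exact: mg.
  rewrite -ge0_integral_setU//=.
  - by rewrite itv_setU_setT.
  - by move=> x _; rewrite lee_fin.
  - exact: disjoint_rays.
move=> cG G0.
have cGN : continuous (fun x => G (- x)).
  by move=> x; apply: continuous_comp; [exact: oppr_continuous|exact: cG].
rewrite (split_integral G)// (split_integral (fun x => G (- x)))//=.
by rewrite addeC; congr (_ + _)%E; apply: eq_integral => x _; rewrite opprK.
Qed.

End normal_moments.

(** * A centred Gaussian law is determined by its variance *)

Section gaussian_law.
Context d {T : measurableType d} {R : realType} (P : probability T R).
Notation mu := (@lebesgue_measure R).

(** Second moments about every point [a] are what later identifies the parameters of the law. *)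
Lemma integral_sqr_centered (Y : {RV P >-> R}) (v a : R) :
  P.-integrable setT (EFin \o Y) -> (\int[P]_w (Y w)%:E = 0)%E ->
  (\int[P]_w (Y w ^+ 2)%:E = v%:E)%E ->
  (\int[P]_w ((Y w - a) ^+ 2)%:E = (v + a ^+ 2)%:E)%E.
Proof.
move=> iY Y0 Y2.
have iY2 : P.-integrable setT (fun w => (Y w ^+ 2)%:E).
  apply/integrableP; split; first exact/measurable_EFinP/measurable_funX.
  rewrite (_ : (\int[P]_w `|_|)%E = v%:E) ?ltry// -Y2; apply: eq_integral => w _.
  by rewrite gee0_abs// lee_fin sqr_ge0.
have iaY : P.-integrable setT (fun w => (- 2 * a)%:E * (Y w)%:E)%E.
  by apply: integrableZl.
have ia : P.-integrable setT (fun=> (a ^+ 2)%:E).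
  exact: finite_measure_integrable_cst.
transitivity (\int[P]_w ((Y w ^+ 2)%:E +
    ((- 2 * a)%:E * (Y w)%:E + (a ^+ 2)%:E)))%E.
  by apply: eq_integral => w _; rewrite -EFinM -!EFinD; congr (_%:E); ring.
rewrite integralD//; last exact: integrableD.
rewrite integralD// integralZl// Y0 mule0 add0e integral_cst// Y2.
rewrite EFinD; congr (_ + _)%E; rewrite -[RHS]mule1; congr (_ * _)%E; exact: probability_setT.
Qed.

Lemma integral_of_law (Y : {RV P >-> R}) 
    (nu : {measure set R -> \bar R}) (g : R -> \bar R) :
  (forall A, measurable A -> P (Y @^-1` A) = nu A) ->
  measurable_fun setT g -> (forall x, 0 <= g x)%E ->
  (\int[P]_w g (Y w) = \int[nu]_x g x)%E.
Proof.
move=> law mg g0; rewrite -(ge0_integral_distribution Y mg g0).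
by apply: eq_measure_integral => A mA _; exact: law.
Qed.

(** The law of [Y] and [normal_prob] live on different displays; the image of the latter under
    [idTR] links them. *)
Lemma integral_of_normal_law (Y : {RV P >-> R}) (m s : R) (g : R -> \bar R) :
  (forall A, measurable A -> P (Y @^-1` A) = normal_prob m s A) ->
  measurable_fun setT g -> (forall x, 0 <= g x)%E ->
  (\int[P]_w g (Y w) = \int[normal_prob m s]_x g x)%E.
Proof.
move=> law mg g0.
rewrite (integral_of_law (nu := distribution (normal_prob m s) (@idTR R)))//.
by rewrite ge0_integral_distribution.
Qed.

(** [is_gaussian] only provides some [m] and [s], with [s] possibly zero or negative. Comparing
    second moments about several points forces [m = 0] and [s^2 = v]. *)
Lemma gaussian_cdf (Z : T -> R) (v x : R) : measurable_fun setT Z ->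
  is_gaussian P Z -> 0 < v ->
  P.-integrable setT (EFin \o Z) -> (\int[P]_w (Z w)%:E = 0)%E ->
  (\int[P]_w (Z w ^+ 2)%:E = v%:E)%E ->
  P (Z @^-1` `]-oo, x]) = (Phi (x / Num.sqrt v))%:E.
Proof.
move=> mZ [m [s law]] v0 iY Y0 Y2.
pose Y : {RV P >-> R} := HB.pack Z (isMeasurableFun.Build _ _ _ _ Z mZ).
rewrite -[Z]/(Y : T -> R) in law iY Y0 Y2 *.
have sqr_law a := integral_sqr_centered a iY Y0 Y2.
have mg a : measurable_fun setT (fun x : R => ((x - a) ^+ 2)%:E).
  by apply/measurable_EFinP; apply: measurable_funX; exact: measurable_funB.
have g0 (a y : R) : (0 <= ((y - a) ^+ 2)%:E)%E by rewrite lee_fin sqr_ge0.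
have [s0|s0] := eqVneq s 0.
  have lawd A : measurable A -> P (Y @^-1` A) = \d_m A.
    by move=> mA; rewrite law// /gaussian_law s0 eqxx.
  (* At [a = m] this reads [v + m^2 = 0], against [v > 0]: the Dirac case is impossible. *)
  have E a : v + a ^+ 2 = (m - a) ^+ 2.
    have := sqr_law a; rewrite (integral_of_law lawd (mg a) (g0 a)).
    by rewrite integral_dirac// diracT mul1e => -[].
  have := E 0; have := E m; rewrite subrr subr0 expr0n/= => ? ?.
  by exfalso; have := sqr_ge0 m; lra.
(* The density depends on [s] only through [s^2], so [s] may be taken positive. *)
have lawn A : measurable A -> P (Y @^-1` A) = normal_prob m `|s| A.
  move=> mA; rewrite law// /gaussian_law (negbTE s0).
  by rewrite /normal_prob normal_pdf_norm.
move: lawn; have : 0 < `|s| by rewrite normr_gt0.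
move: (`|s| : R) => {law s0}s s0 law.
have s1 : s != 0 by rewrite gt_eqF.
have cg (c e : R) : continuous (fun z : R => (c + e * z) ^+ 2).
  by move=> z; apply: is_derive_continuous.
have sqr_pdf a : (v + a ^+ 2)%:E =
    (\int[mu]_z (((m - a) + s * z) ^+ 2 * normal_pdf 0 1 z)%:E)%E.
  have := sqr_law a; rewrite (integral_of_normal_law law (mg a) (g0 a)) => <-.
  rewrite integral_normal_prob; [|exact: s1|exact: mg|]; last first.
    under eq_integral do rewrite gee0_abs//.
    by rewrite -(integral_of_normal_law law (mg a) (g0 a)) sqr_law ltry.
  have := @integral_normal_pdf_scale R m s (fun x => (x - a) ^+ 2) s0.
  move=> -> //.
  - by apply: eq_integral => z _; congr ((_ ^+ 2 * _)%:E); ring.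
  - move=> z; have := cg (- a) 1 z.
    by under eq_fun do rewrite mul1r addrC.
  - by move=> z; exact: sqr_ge0.
(* The law is symmetric about [m], so [E Y^2 = E (2m - Y)^2 = E Y^2 + 4m^2]. *)
have m0 : m = 0.
  have := sqr_pdf (2 * m); rewrite ge0_integral_oppr; last 2 first.
  - by move=> z; apply: cvgM; [exact: cg|exact: continuous_phi].
  - by move=> z; rewrite mulr_ge0 ?sqr_ge0 ?normal_pdf_ge0.
  have := sqr_pdf 0; rewrite subr0 expr0n/= addr0 => E0.
  rewrite (_ : (\int[mu]_z _)%E = v%:E).
    by move=> [] ?; apply/eqP; rewrite -sqrf_eq0; apply/eqP; lra.
  rewrite E0; apply: eq_integral => z _; rewrite normal_pdf_even.
  by congr ((_ * _)%:E); ring.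
have vs : v = s ^+ 2.
  apply/EFin_inj; have := sqr_pdf 0; rewrite expr0n/= addr0 m0 subr0 => ->.
  rewrite -[RHS]mule1 -integral_sqr_normal_pdf -ge0_integralZl//.
  - by apply: eq_integral => z _; rewrite -EFinM add0r; congr (_%:E); ring.
  - apply/measurable_EFinP; apply: measurable_funM; first exact: measurable_funX.
    exact: measurable_normal_pdf.
  - by move=> z _; rewrite lee_fin mulr_ge0 ?sqr_ge0 ?normal_pdf_ge0.
  - by rewrite lee_fin sqr_ge0.
rewrite law// m0 -normal_cdfK normal_cdf_scale// vs sqrtr_sqr gtr0_norm//.
Qed.

End gaussian_law.

(** * Moments of linear combinations of fractional Brownian motion *)

Section fBm_combinations.
Context d {T : measurableType d} {R : realType} (P : probability T R).
Variables (H : R) (B : R -> {RV P >-> R}).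
Hypothesis fBmB : is_fBm H B.

Lemma fBm_covE t s :
  (\int[P]_w (B t w * B s w)%:E = (fBm_cov (2 * H) t s)%:E)%E.
Proof. by case: fBmB => _ _ /(_ t s); rewrite unlock. Qed.

Lemma fBm_integrable_sqr t : P.-integrable setT (fun w => (B t w ^+ 2)%:E).
Proof.
apply/integrableP; split; first exact/measurable_EFinP/measurable_funX.
rewrite (_ : (\int[P]_w `|_|)%E = (fBm_cov (2 * H) t t)%:E) ?ltry//.
rewrite -fBm_covE; apply: eq_integral => w _.
by rewrite gee0_abs ?lee_fin ?sqr_ge0.
Qed.

(** Domination by [B_t^2 + B_s^2]. *)
Lemma fBm_integrableM t s : P.-integrable setT (fun w => (B t w * B s w)%:E).
Proof.
apply: (le_integrable _ _ _
  (integrableD measurableT (fBm_integrable_sqr t) (fBm_integrable_sqr s))) => //.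
  exact/measurable_EFinP/measurable_funM.
move=> w _; rewrite -EFinD !abse_EFin lee_fin ler_norml.
rewrite [X in _ <= _ <= X]ger0_norm ?addr_ge0 ?sqr_ge0//.
rewrite [X in - X]ger0_norm ?addr_ge0 ?sqr_ge0//.
have := sqr_ge0 (B t w - B s w); have := sqr_ge0 (B t w + B s w).
have := sqr_ge0 (B t w); have := sqr_ge0 (B s w).
by move=> ? ? ? ?; apply/andP; split; nra.
Qed.

(** Domination by [1 + B_t^2]. *)
Lemma fBm_integrable t : P.-integrable setT (EFin \o B t).
Proof.
have i1 : P.-integrable setT (fun=> 1%:E : \bar R).
  exact: finite_measure_integrable_cst.
apply: (le_integrable _ _ _
  (integrableD measurableT i1 (fBm_integrable_sqr t))) => //.
  exact/measurable_EFinP.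
move=> w _; rewrite -EFinD !abse_EFin lee_fin.
rewrite [leRHS]ger0_norm ?addr_ge0 ?sqr_ge0// -[B t w ^+ 2]real_normK ?num_real//.
have := sqr_ge0 (`|B t w| - 1); have := normr_ge0 (B t w); nra.
Qed.

Variables (n : nat) (a u : 'I_n -> R).
Let Y (w : T) : R := \sum_(i < n) a i * B (u i) w.

Lemma measurable_fBm_sum : measurable_fun setT Y.
Proof. by apply: measurable_sum => i; exact: measurable_funM. Qed.

Lemma integrable_fBm_sum : P.-integrable setT (EFin \o Y).
Proof.
rewrite (_ : _ \o _ = fun w => \sum_(i < n) ((a i)%:E * (B (u i) w)%:E)%E)%E.
  apply: integrable_sum => // i _; apply: integrableZl => //.
  exact: fBm_integrable.
by apply/funext => w; rewrite /Y /= -sumEFin.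
Qed.

Lemma fBm_sum_mean : (\int[P]_w (Y w)%:E = 0)%E.
Proof.
under eq_integral do rewrite /Y -sumEFin.
rewrite integral_sum//; last first.
  move=> i; under eq_fun do rewrite EFinM; apply: integrableZl => //.
  exact: fBm_integrable.
apply: big1 => i _; under eq_integral do rewrite EFinM.
rewrite integralZl//; last exact: fBm_integrable.
by case: fBmB => _ /(_ (u i)) + _ _; rewrite unlock => ->; rewrite mule0.
Qed.

(** The nested form of the double sum allows the inner and the outer sum to be rewritten in turn as
    Riemann sums. *)
Lemma fBm_sum_variance : (\int[P]_w (Y w ^+ 2)%:E =
  (\sum_(i < n) a i * \sum_(j < n) a j * fBm_cov (2 * H) (u i) (u j))%:E)%E.
Proof.
have iM i j : P.-integrable setT
    (fun w => ((a i * a j) * (B (u i) w * B (u j) w))%:E).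
  under eq_fun do rewrite EFinM; apply: integrableZl => //.
  exact: fBm_integrableM.
transitivity (\int[P]_w (\sum_(i < n) \sum_(j < n)
    ((a i * a j) * (B (u i) w * B (u j) w))%:E))%E.
  apply: eq_integral => w _; rewrite /Y expr2 mulr_suml -sumEFin.
  apply: eq_bigr => i _; rewrite mulr_sumr -sumEFin.
  by apply: eq_bigr => j _; congr (_%:E); ring.
rewrite integral_sum//; last by move=> i; exact: integrable_sum.
rewrite -sumEFin; apply: eq_bigr => i _.
rewrite integral_sum// mulr_sumr -sumEFin; apply: eq_bigr => j _.
under eq_integral do rewrite EFinM.
by rewrite integralZl ?fBm_covE -?EFinM ?mulrA//; exact: fBm_integrableM.
Qed.

End fBm_combinations.

(** * Distribution function of an almost sure limit *)

Section limit_law.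
Context d {T : measurableType d} {R : realType} (P : probability T R).

Lemma cdf_shift (Y Z : T -> R) (A : set T) (x e : R) :
  measurable_fun setT Y -> measurable_fun setT Z -> measurable A ->
  (forall w, ~ A w -> `|Y w - Z w| < e) ->
  (P (Y @^-1` `]-oo, x]) <= P (Z @^-1` `]-oo, (x + e)%R]) + P A)%E.
Proof.
move=> mY mZ mA YZ.
have mZx : measurable (Z @^-1` `]-oo, (x + e)%R]).
  by rewrite -[_ @^-1` _]setTI; exact: mZ.
have mYx : measurable (Y @^-1` `]-oo, x]).
  by rewrite -[_ @^-1` _]setTI; exact: mY.
apply: le_trans (measureU2 _ mZx mA); apply: le_measure.
- by rewrite inE.
- by rewrite inE; exact: measurableU.
move=> w /=; rewrite !in_itv/= => Yx.
have [Aw|nAw] := pselect (A w); [by right|left].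
by have := YZ w nAw; rewrite ltr_norml => /andP[? ?] /=; lra.
Qed.

(** By Egorov's theorem the convergence is uniform off a set of small probability; [cdf_shift] in
    both directions then traps the limit distribution function between shifted values of [F], and
    continuity of [F] closes the gap. *)
Lemma cdf_limit (Y_ : nat -> T -> R) (Y : T -> R) (G : nat -> R -> R)
    (F : R -> R) (x : R) :
  (forall n, measurable_fun setT (Y_ n)) -> measurable_fun setT Y ->
  {ae P, forall w, Y_ ^~ w @ \oo --> Y w} ->
  (\forall n \near \oo, forall y,
    P (Y_ n @^-1` `]-oo, y]) = (G n y)%:E) ->
  (forall y, G ^~ y @ \oo --> F y) -> continuous F ->
  P (Y @^-1` `]-oo, x]) = (F x)%:E.
Proof.
move=> mY_ mY YY law GF cF.
have mYx : measurable (Y @^-1` `]-oo, x]).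
  by rewrite -[_ @^-1` _]setTI; exact: mY.
pose p := fine (P (Y @^-1` `]-oo, x])).
have pE : P (Y @^-1` `]-oo, x]) = p%:E by rewrite fineK// fin_num_measure.
rewrite pE; congr (_%:E).
(* One [e] pays for the exceptional set, the other for replacing [G n] by [F]. *)
have bounds (e dl : R) : 0 < e -> 0 < dl ->
    F (x - dl) - 2 * e <= p <= F (x + dl) + 2 * e.
  move=> e0 dl0.
  have YY' : {ae P, forall w, setT w -> Y_ ^~ w @ \oo --> Y w}.
    by apply: filterS YY => w Yw _.
  have Poo : (P setT < +oo)%E by rewrite (le_lt_trans (probability_le1 _ _)) ?ltry.
  have [A [mA Ae unif]] :=
    ae_pointwise_almost_uniform mY_ mY measurableT Poo YY' e0.
  have near_unif : \forall n \near \oo, forall w, ~ A w -> `|Y_ n w - Y w| < dl.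
    have : \forall n \near \oo,
        forall w, (setT `\` A) w -> ball (Y w) dl (Y_ n w).
      apply: (unif [set h | forall w, (setT `\` A) w -> ball (Y w) dl (h w)]).
      apply/uniform_nbhs; exists [set xy | ball xy.1 dl xy.2].
      by split => //; exact: (@entourage_ball _ _ (PosNum dl0)).
    by apply: filterS => n U w nAw; rewrite distrC; exact: U.
  near \oo => n.
  have lawn : forall y, P (Y_ n @^-1` `]-oo, y]) = (G n y)%:E by near: n.
  have un : forall w, ~ A w -> `|Y_ n w - Y w| < dl by near: n.
  have un' w : ~ A w -> `|Y w - Y_ n w| < dl by move/un; rewrite distrC.
  have G1 : `|F (x - dl) - G n (x - dl)| < e.
    by near: n; have := GF (x - dl) => /cvgrPdist_lt; exact.
  have G2 : `|F (x + dl) - G n (x + dl)| < e.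
    by near: n; have := GF (x + dl) => /cvgrPdist_lt; exact.
  have H1 := cdf_shift x mY (mY_ n) mA un'.
  have H2 := cdf_shift (x - dl) (mY_ n) mY mA un.
  rewrite subrK pE lawn in H2; rewrite pE lawn in H1.
  have PA : P A = (fine (P A))%:E by rewrite fineK// fin_num_measure.
  rewrite PA in H1 H2; rewrite -!EFinD !lee_fin in H1 H2.
  have Ae' : fine (P A) < e by rewrite -lte_fin -PA.
  move: G1 G2; rewrite !ltr_norml.
  by move=> /andP[? ?] /andP[? ?]; apply/andP; split; lra.
apply/eqP; rewrite -subr_eq0 -normr_le0; apply/ler_addgt0Pl => e e0.
rewrite addr0; have e3 : 0 < e / 3 by rewrite divr_gt0.
have := cF x => /cvgrPdist_lt/(_ _ e3)/nbhs_ballP[r /= r0 Fr].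
have r2 : 0 < r / 2 by rewrite divr_gt0.
have /andP[b1 b2] := bounds _ _ e3 r2.
have F1 : `|F x - F (x - r / 2)| < e / 3.
  by apply: Fr; rewrite /ball/= opprB addrCA subrr addr0 gtr0_norm//; lra.
have F2 : `|F x - F (x + r / 2)| < e / 3.
  by apply: Fr; rewrite /ball/= opprD addrA subrr add0r normrN gtr0_norm//; lra.
move: F1 F2; rewrite !ltr_norml ler_norml => /andP[? ?] /andP[? ?].
by apply/andP; split; lra.
Unshelve. all: end_near. Qed.

End limit_law.

(** * The law of the fractional Ornstein-Uhlenbeck process at time [t] *)

Section OU_law.
Context d {T : measurableType d} {R : realType} (P : probability T R).
Notation mu := (@lebesgue_measure R).

Lemma continuous_Phi : continuous (@Phi R).
Proof.
move=> x; have := is_derive_normal_cdf x (oner_neq0 R).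
by rewrite normal_cdf1 => /is_derive_continuous.
Qed.

(** A continuous distribution function has no atoms: the open half-line has at least the mass
    [F (x - r / 2)], which is as close to [F x] as desired. *)
Lemma lt_measure_cdf (Y : T -> R) (F : R -> R) (x : R) :
  measurable_fun setT Y -> continuous F ->
  (forall y, P (Y @^-1` `]-oo, y]) = (F y)%:E) ->
  P (Y @^-1` `]-oo, x[) = (F x)%:E.
Proof.
move=> mY cF law.
have mYlt : measurable (Y @^-1` `]-oo, x[) by rewrite -[_ @^-1` _]setTI; exact: mY.
have mYle y : measurable (Y @^-1` `]-oo, y]).
  by rewrite -[_ @^-1` _]setTI; exact: mY.
have up : (P (Y @^-1` `]-oo, x[) <= (F x)%:E)%E.
  rewrite -law; apply: le_measure; rewrite ?inE//.
  by move=> w /=; rewrite !in_itv/= => /ltW.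
pose p := fine (P (Y @^-1` `]-oo, x[)).
have pE : P (Y @^-1` `]-oo, x[) = p%:E by rewrite fineK// fin_num_measure.
rewrite pE lee_fin in up; rewrite pE; congr (_%:E).
apply/eqP; rewrite eq_le up/=; apply/ler_addgt0Pr => e e0.
have := cF x => /cvgrPdist_lt/(_ _ e0)/nbhs_ballP[r /= r0 Fr].
have F1 : `|F x - F (x - r / 2)| < e.
  have r2 : 0 < r / 2 by rewrite divr_gt0.
  by apply: Fr; rewrite /ball/= opprB addrCA subrr addr0 gtr0_norm//; lra.
have F2 : F (x - r / 2) <= p.
  rewrite -lee_fin -pE -law; apply: le_measure; rewrite ?inE//.
  move=> w /=; rewrite !in_itv/= => /le_lt_trans; apply.
  by rewrite ltrBlDr ltrDl divr_gt0.
by move: F1; rewrite ltr_norml => /andP[? ?]; lra.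
Qed.

Variables (H : R) (B : R -> {RV P >-> R}).
Hypothesis H0 : 0 < H.
Hypothesis fBmB : is_fBm H B.
Variables (theta x0 t : R) (X : R -> {RV P >-> R}).
Hypothesis t0 : 0 < t.
Hypothesis fOUX : is_fOU B theta x0 X.

(* [B_t] followed by the nodes of the Riemann sum. *)
Let weight n (i : 'I_n.+2) : R :=
  if unlift ord0 i is Some j
  then t / n.+1%:R * OU_kernel theta t (j%:R * (t / n.+1%:R)) else 1.

Let node n (i : 'I_n.+2) : R :=
  if unlift ord0 i is Some j then j%:R * (t / n.+1%:R) else t.

(** Stated for arbitrary [g], so that it serves both the paths of [B] and each variable of the
    covariance. *)
Let sum_node n (g : R -> R) : \sum_(i < n.+2) weight i * g (node i) =
  g t + riemann_sum t n.+1 (fun s => OU_kernel theta t s * g s).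
Proof.
rewrite big_ord_recl /weight /node unlift_none mul1r; congr (_ + _).
rewrite /riemann_sum; apply: eq_bigr => i _.
by rewrite !liftK -mulrA.
Qed.

Let approx n (w : T) : R := \sum_(i < n.+2) weight i * B (node i) w.

Let approx_variance n : R :=
  fBm_cov (2 * H) t t
  + 2 * riemann_sum t n.+1 (fun s => OU_kernel theta t s * fBm_cov (2 * H) t s)
  + riemann_sum t n.+1 (fun s => OU_kernel theta t s *
     riemann_sum t n.+1 (fun u => OU_kernel theta t u * fBm_cov (2 * H) s u)).

Let approx_varianceE n :
  (\int[P]_w (approx n w ^+ 2)%:E = (approx_variance n)%:E)%E.
Proof.
rewrite (fBm_sum_variance fBmB (@weight n) (@node n)); congr (_%:E).
pose g s := fBm_cov (2 * H) s t +
  riemann_sum t n.+1 (fun u => OU_kernel theta t u * fBm_cov (2 * H) s u).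
rewrite (eq_bigr (fun i => weight i * g (node i))); last first.
  by move=> i _; rewrite (sum_node n (fBm_cov (2 * H) (node i))).
rewrite sum_node /g /approx_variance.
rewrite (_ : riemann_sum t n.+1 (fun s => _ * (_ + _)) =
  riemann_sum t n.+1 (fun s => OU_kernel theta t s * fBm_cov (2 * H) t s) +
  riemann_sum t n.+1 (fun s => OU_kernel theta t s *
     riemann_sum t n.+1 (fun u => OU_kernel theta t u * fBm_cov (2 * H) s u))).
  by ring.
rewrite /riemann_sum -big_split/=; apply: eq_bigr => i _.
by rewrite (fBm_covC _ _ t); ring.
Qed.

(** The centred variable [Y] is the almost sure limit of the sums [approx n], which are centred
    Gaussian with variances tending to [vOU]; [cdf_limit] transfers their distribution functions to
    [Y]. *)
Lemma fOU_cdf (x : R) : P (X t @^-1` `]-oo, x]) =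
  (Phi ((x - x0 * expR (theta * t)) / Num.sqrt (vOU H theta t)))%:E.
Proof.
have p0 : 0 < 2 * H by rewrite mulr_gt0.
have v0 := vOU_gt0 theta H0 t0.
set v := vOU H theta t in v0 *.
have cvgv : approx_variance n @[n --> \oo] --> v.
  have [E dE E0] := OU_primitive theta p0.
  rewrite /v (vOU_integral H0 t0 dE E0).2.
  exact: cvg_riemann_variance p0 dE E0 t (ltW t0).
pose Y (w : T) : R := X t w - x0 * expR (theta * t).
have -> : X t @^-1` `]-oo, x] = Y @^-1` `]-oo, x - x0 * expR (theta * t)].
  by apply/seteqP; split => w /=; rewrite !in_itv/= lerD2r.
apply: (@cdf_limit _ _ _ P approx Y (fun n y => Phi (y / Num.sqrt (approx_variance n)))
  (fun y => Phi (y / Num.sqrt v))).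
- by move=> n; exact: measurable_fBm_sum.
- exact: measurable_funB.
- case: fBmB => _ _ _ cB; apply: filterS2 fOUX cB => w XE cB.
  rewrite (_ : approx ^~ w = fun n => B t w +
      riemann_sum t n.+1 (fun s => OU_kernel theta t s * B s w)).
    exact: (OU_path_cvg (x := fun s => X s w) t0 XE cB).
  by apply/funext => n; rewrite /approx (sum_node n (fun s => B s w)).
(* Positivity of the variances, demanded by [gaussian_cdf], is inherited from the positive limit and
   hence holds eventually. *)
- have : \forall n \near \oo, 0 < approx_variance n.
    exact: (cvgr_gt v).
  apply: filterS => n vn0 y.
  apply: (gaussian_cdf y (measurable_fBm_sum _ _ _) _ vn0).
  + by case: fBmB => + _ _ _; exact.
  + exact: (integrable_fBm_sum fBmB).
  + exact: (fBm_sum_mean fBmB).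
  + exact: approx_varianceE.
- move=> y; apply: (cvg_comp _ (@Phi R)); last exact: continuous_Phi.
  apply: cvgM; first exact: cvg_cst.
  apply: cvgV; first by rewrite gt_eqF// sqrtr_gt0.
  apply: (cvg_comp _ (@Num.sqrt R) cvgv); exact: sqrt_continuous.
- move=> y; apply: (cvg_comp (fun y => y / Num.sqrt v) (@Phi R)).
    by apply: cvgM; [exact: cvg_id|exact: cvg_cst].
  exact: continuous_Phi.
Qed.

(** The event is [X_t <= K] minus [X_t < - K]; continuity of the law handles the strict inequality
    and [PhiN] turns the difference into the stated sum. *)
Lemma fOU_norm_le (K : R) : 0 <= K ->
  P [set w | `|X t w| <= K] =
  (Phi ((K - x0 * expR (theta * t)) / Num.sqrt (vOU H theta t)) +
   Phi ((K + x0 * expR (theta * t)) / Num.sqrt (vOU H theta t)) - 1)%:E.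
Proof.
move=> K0.
set m := x0 * expR (theta * t); set s := Num.sqrt (vOU H theta t).
have mX : measurable_fun setT (X t) by [].
have cF : continuous (fun y => Phi ((y - m) / s)).
  move=> y; apply: (cvg_comp (fun y => (y - m) / s) (@Phi R)).
    by apply: cvgM; [apply: cvgB; [exact: cvg_id|]|]; exact: cvg_cst.
  exact: continuous_Phi.
have -> : [set w | `|X t w| <= K] = X t @^-1` `]-oo, K] `\` X t @^-1` `]-oo, (- K)[.
  apply/seteqP; split => w /=; rewrite !in_itv/= ler_norml.
    by move=> /andP[? ->]; split => //; apply/negP; rewrite -leNgt.
  by move=> [-> /negP]; rewrite -leNgt andbT.
have mle : measurable (X t @^-1` `]-oo, K]).
  by rewrite -[_ @^-1` _]setTI; exact: mX.
have mlt : measurable (X t @^-1` `]-oo, (- K)[).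
  by rewrite -[_ @^-1` _]setTI; exact: mX.
have fin (A : set T) : measurable A -> (P A < +oo)%E.
  by move=> mA; rewrite (le_lt_trans (probability_le1 _ mA)) ?ltry.
rewrite measureD//; last exact: fin.
rewrite setIidr; last first.
  move=> w /=; rewrite !in_itv/= => /ltW/le_trans; apply.
  by rewrite (le_trans _ K0)// oppr_le0.
have E := f_equal2 (fun a b => a - b)%E (fOU_cdf K)
  (lt_measure_cdf (- K) mX cF fOU_cdf).
apply: (etrans E); rewrite -EFinB; congr (_%:E).
rewrite -/m -/s (_ : (- K - m) / s = - ((K + m) / s)); last by ring.
by rewrite PhiN; ring.
Qed.

End OU_law.

(** * Normal probability of a symmetric interval, and the event for [Zstat] *)

Section monotonicity.
Context {R : realType}.
Implicit Types (k m x y : R).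

Lemma normal_pdf_gt0 m s x : s != 0 -> 0 < normal_pdf m s x :> R.
Proof.
by move=> s0; rewrite normal_pdfE// mulr_gt0 ?normal_peak_gt0// expR_gt0.
Qed.

Lemma lt_Phi x y : x < y -> Phi x < Phi y.
Proof.
move=> xy; have dPhi z := is_derive_normal_cdf z (oner_neq0 R).
rewrite normal_cdf1 in dPhi.
have [|c _ E] := @MVT_within _ (@Phi R) (normal_pdf 0 1) x y (ltW xy) (fun z _ _ => dPhi z).
  by apply: continuous_subspaceT; exact: continuous_Phi.
by rewrite -subr_gt0 E mulr_gt0 ?subr_gt0// normal_pdf_gt0 ?oner_neq0.
Qed.

(* The derivative in [m] is [phi (k + m) - phi (k - m)], nonpositive since
   [|k - m| <= |k + m|]. *)
Lemma Phi_interval_nincr k m1 m2 : 0 <= k -> 0 <= m1 -> m1 <= m2 ->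
  Phi (k - m2) + Phi (k + m2) <= Phi (k - m1) + Phi (k + m1).
Proof.
move=> k0 m10 m12.
have dQ (z : R) : is_derive z 1 (fun m => Phi (k - m) + Phi (k + m))
    (normal_pdf 0 1 (k + z) - normal_pdf 0 1 (k - z)).
  have d1 := is_derive_normal_cdf (k - z) (oner_neq0 R).
  have d2 := is_derive_normal_cdf (k + z) (oner_neq0 R).
  rewrite normal_cdf1 in d1 d2; apply: is_derive_eq; ring.
have [|c /andP[c1 _] E] := MVT_within m12 (fun z _ _ => dQ z).
  by apply: continuous_subspaceT => z; exact: is_derive_continuous (dQ z).
rewrite -subr_le0 E mulr_le0_ge0 ?subr_ge0// subr_le0.
rewrite !normal_pdfE ?oner_neq0// ler_wpM2l ?normal_peak_ge0//.
rewrite /normal_fun !subr0 ler_expR expr1n ler_wpM2r ?invr_ge0// lerN2.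
have := mulr_ge0 k0 (le_trans m10 c1); nra.
Qed.

(** Two comparisons: at fixed half-width [K / s2], lower the mean from [|m2| / s2] to [|m1| / s1];
    then at this fixed mean, widen strictly to [K / s1]. *)
Lemma lt_Phi_interval (K s1 s2 m1 m2 r : R) : 0 < K -> 0 < s1 -> s1 < s2 ->
  s2 <= r * s1 -> `|m2| = r * `|m1| ->
  Phi ((K - m2) / s2) + Phi ((K + m2) / s2) <
  Phi ((K - m1) / s1) + Phi ((K + m1) / s1).
Proof.
move=> K0 s10 s12 s2r m21; have s20 : 0 < s2 by exact: lt_trans s12.
(* The sum is even in the mean, so only [|m|] matters. *)
have norm_arg (m s : R) : Phi ((K - m) / s) + Phi ((K + m) / s) =
    Phi (K / s - `|m| / s) + Phi (K / s + `|m| / s).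
  have [m0|m0] := leP 0 m; first by rewrite ger0_norm// mulrBl mulrDl.
  by rewrite ltr0_norm// addrC mulrBl mulrDl !mulNr opprK.
rewrite (norm_arg m2 s2) (norm_arg m1 s1).
apply: (@le_lt_trans _ _ (Phi (K / s2 - `|m1| / s1) + Phi (K / s2 + `|m1| / s1))).
  apply: Phi_interval_nincr.
  - by rewrite divr_ge0 ?ltW.
  - by rewrite divr_ge0// ltW.
  - rewrite m21 ler_pdivrMr// mulrAC ler_pdivlMr// [r * _]mulrC -mulrA.
    by rewrite ler_wpM2l.
have Ks : K / s2 < K / s1 by rewrite ltr_pM2l// ltf_pV2 ?posrE.
by apply: ltrD; apply: lt_Phi; [rewrite ltrD2r|rewrite ltrD2r].
Qed.

Lemma Zstat_ge0 (t x : R) : 1 < t -> 0 <= Zstat t x.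
Proof.
move=> t1; rewrite /Zstat divr_ge0 ?ln_ge0 ?(ltW t1)// fine_ge0// /logplus.
by case: ifPn => // /ltW y1; rewrite lne_ge0.
Qed.

(** Where the positive logarithm vanishes, that is for [|x| <= e] including [x = 0], both sides are
    true because [t^c >= 1]; elsewhere the two logarithms are inverted. *)
Lemma Zstat_le (t c x : R) : 1 < t -> 0 <= c ->
  (Zstat t x <= c) = (`|x| <= expR (t `^ c)).
Proof.
move=> t1 c0; have t0 : 0 < t by rewrite (lt_trans _ t1).
have lnt : 0 < ln t by rewrite ln_gt0.
have tc : 1 <= t `^ c by rewrite -[leLHS](powRr0 t) ler_powR// ltW.
rewrite /Zstat /logplus; have [x0|x0] := eqVneq `|x| 0.
  by rewrite x0 le0_lneNy//= mul0r c0 expR_ge0.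
have xpos : 0 < `|x| by rewrite lt_def x0 normr_ge0.
rewrite lne_EFin//; have [l1|l1] := ltP 1 (ln `|x|).
  rewrite lte_fin l1 lne_EFin ?(lt_trans _ l1)//= ler_pdivrMr//.
  rewrite -ln_powR ler_ln ?posrE ?(lt_trans _ l1) ?powR_gt0//.
  by rewrite -[in RHS](lnK xpos) ler_expR.
rewrite lte_fin ltNge l1 /= mul0r c0 -[X in _ = (X <= _)](lnK xpos) ler_expR.
by rewrite (le_trans l1).
Qed.

End monotonicity.

(** For [c < 0] the event is empty because [Zstat] is nonnegative, whereas the closed expression
    stays positive; hence the formula and the strict decrease are stated for [0 <= c], and the weak
    decrease for every [c]. *)
Theorem lemma2p2 (d : measure_display) (T : measurableType d) (R : realType)
    (P : probability T R) (H : R) (B : R -> {RV P >-> R}) (x0 : R)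
    (X : R -> R -> {RV P >-> R}) :
  0 < H -> H < 1 -> is_fBm H B ->
  (forall theta : R, is_fOU B theta x0 (X theta)) ->
  forall t c : R, 1 < t ->
  [/\ 0 <= c -> forall theta : R,
        gprob (X theta) t c =
        (Phi ((expR (t `^ c) - x0 * expR (theta * t))
              / Num.sqrt (vOU H theta t))
         + Phi ((expR (t `^ c) + x0 * expR (theta * t))
                / Num.sqrt (vOU H theta t)) - 1)%:E,
      0 <= c -> forall theta1 theta2 : R, theta1 < theta2 ->
        (gprob (X theta2) t c < gprob (X theta1) t c)%E
    & forall theta1 theta2 : R, theta1 < theta2 ->
        (gprob (X theta2) t c <= gprob (X theta1) t c)%E].
Proof.
move=> H0 _ fBmB fOUX t c t1; have t0 : 0 < t by rewrite (lt_trans _ t1).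
have formula : 0 <= c -> forall theta : R, gprob (X theta) t c =
    (Phi ((expR (t `^ c) - x0 * expR (theta * t)) / Num.sqrt (vOU H theta t))
     + Phi ((expR (t `^ c) + x0 * expR (theta * t)) / Num.sqrt (vOU H theta t))
     - 1)%:E.
  move=> c0 theta.
  rewrite -(fOU_norm_le H0 fBmB t0 (fOUX theta) (expR_ge0 _)) /gprob.
  by congr (P _); apply/seteqP; split => w /=; rewrite Zstat_le.
have decr : 0 <= c -> forall theta1 theta2 : R, theta1 < theta2 ->
    (gprob (X theta2) t c < gprob (X theta1) t c)%E.
  move=> c0 theta1 theta2 th12; rewrite !formula// lte_fin ltrD2r.
  have v1 := vOU_gt0 theta1 H0 t0; have v2 := vOU_gt0 theta2 H0 t0.
  apply: (@lt_Phi_interval _ _ _ _ _ _ (expR ((theta2 - theta1) * t))).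
  - exact: expR_gt0.
  - by rewrite sqrtr_gt0; exact: v1.
  - by rewrite (ltr_sqrt _ v2); exact: lt_vOU.
  (* The square root of [le_vOU_scale], whose factor is the square of [e^{(theta2 - theta1) t}]. *)
  - rewrite -[expR _]gtr0_norm ?expR_gt0// -sqrtr_sqr -sqrtrM ?sqr_ge0//.
    rewrite ler_wsqrtr// -expRM_natr (_ : _ * 2%:R = (theta2 - theta1) * (2 * t)).
      by rewrite le_vOU_scale// ltW.
    by ring.
  - rewrite !normrM !(gtr0_norm (expR_gt0 _)) mulrCA -expRD.
    by congr (_ * expR _); ring.
split=> // theta1 theta2 th12; have [c0|c0] := leP 0 c; first exact/ltW/decr.
have gprob0 theta : gprob (X theta) t c = 0%E.
  rewrite /gprob (_ : [set w | _] = set0) ?measure0//.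
  apply/seteqP; split => // w /=.
  by rewrite leNgt (lt_le_trans c0 (Zstat_ge0 _ t1)).
by rewrite !gprob0.
Qed.
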